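(* There is an absolute constant $c>0$ such that the following holds. Let $F$ be a field of odd positive characteristic $p$, and let $A\subset F_*=F\setminus\{0\}$ be a finite set with $|A|>1$. (a) If $|A|<p^{2/3}$, then $$|A+AA|\ \ge\ c\,|A|^{3/2}\quad\text{and}\quad |A(A+A)|\ \ge\ c\,|A|^{3/2}.$$ (b) If $|A|<p^{5/8}$, then $$|AA+AA|+|(A+A)(A+A)|\ \ge\ c\,|A|^{8/5}.$$
   Context: For finite sets $X,Y\subset F$, $X+Y=\{x+y: x\in X, y\in Y\}$ and $XY=\{xy: x\in X,y\in Y\}$. Thus $A+AA=\{a+bc: a,b,c\in A\}$, $A(A+A)=\{a(b+c): a,b,c\in A\}$, $AA+AA=\{ab+cd: a,b,c,d\in A\}$, $(A+A)(A+A)=\{(a+b)(c+d): a,b,c,d\in A\}$. *)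

(* Defs.v *)
From HB Require Import structures.
From mathcomp Require Import all_boot all_order all_algebra.
From mathcomp Require Import finmap.
From mathcomp Require Import reals exp.

Set Implicit Arguments.
Unset Strict Implicit.
Unset Printing Implicit Defensive.

Import GRing.Theory.
Local Open Scope ring_scope.

Definition sumset (F : fieldType) (X Y : {fset F}) : {fset F} :=
  [fset (x + y)%R | x in X, y in Y]%fset.

Definition prodset (F : fieldType) (X Y : {fset F}) : {fset F} :=
  [fset (x * y)%R | x in X, y in Y]%fset.

(* Main.v *)
Require Import Defs.
From HB Require Import structures.
From mathcomp Require Import all_boot all_order all_algebra.
From mathcomp Require Import finmap.
From mathcomp Require Import reals exp.
From mathcomp Require Import perm boolp zify ring.

(** The sums and products are controlled through the number of solutions of
    [a + b c' = a' + b' c], which counts incidences between the points [(a, b, c)] and the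
    planes given by [(a', b', c')].  Over the field [K = F(t)] a point becomes a "red" line
    contained in a plane [u = beta] of 3-space, a plane becomes a "blue" line contained in a
    plane [v = b], incidence becomes intersection, and the transcendental [t] makes all the
    [beta] and all the [b] distinct, so that lines of one colour are disjoint.

    Take a surface [f(u, v, Z) = 0] of small degree through a group of red lines.  A blue line
    that does not lie on an irreducible factor [f] meets at most [deg f] of the red lines on it.
    A red line is straight in its plane [u = beta], so the curvature of the plane curve
    [f(beta, v, Z) = 0], a polynomial of degree at most [3 deg f], vanishes on it: a blue line on
    [f] on which the curvature is not identically zero meets at most [3 deg f] red lines.  If [f]
    does not divide its curvature, elimination of [Z] leaves at most [6 (deg f)^2] other blue
    lines.  If it does, then (the characteristic exceeding the degree) the plane sections of [f]
    are lines, hence [f] has degree one in [v] and [Z], and its blue lines correspond to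
    collinear planes, of which there are few.  Splitting the red lines into boundedly many groups
    and iterating on the few remaining blue lines gives [O(N^(3/2))] incidences between [N]
    points and [N] planes when [N <= p^2].  The bounds on the expanders follow from the
    Cauchy-Schwarz inequality; in the last one the estimate [|A+A|^2 |AA|^3 >> |A|^6], obtained by
    writing [a + c = (a b) / b + c], decides which of the two sets is large. *)

Set Implicit Arguments.
Unset Strict Implicit.
Unset Printing Implicit Defensive.

Import Order.TTheory GRing.Theory Num.Theory.
Local Open Scope ring_scope.

(** * Factorial domains with an additive degree *)

(** This is ordinary irreducibility as soon as nonzero elements of degree 0 are units, which
    [degree_unit] demands. *)
Definition degree_irreducible (R : idomainType) (dg : R -> nat) (x : R) : Prop :=
  [/\ x != 0, (0 < dg x)%N & forall a b, x = a * b -> dg a = 0%N \/ dg b = 0%N].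

Definition divides (R : idomainType) (x y : R) : Prop := exists q, y = q * x.

(** Unique factorisation in disguise: the additive degree makes factorisation terminate and
    [irreducible_prime] makes it unique. In this form it passes to polynomial rings. *)
Record factorial_degree (R : idomainType) (dg : R -> nat) : Prop := FactorialDegree {
  degree0 : dg 0 = 0%N;
  degreeD : forall x y : R, (dg (x + y)%R <= maxn (dg x) (dg y))%N;
  degreeM : forall x y : R, x != 0 -> y != 0 -> dg (x * y)%R = (dg x + dg y)%N;
  degree_unit : forall x : R, x != 0 -> dg x = 0%N -> x \is a GRing.unit;
  irreducible_prime : forall x a b : R, degree_irreducible dg x ->
    divides x (a * b) -> divides x a \/ divides x b }.

(** The total degree, if [dg] is the total degree in the inner variables. Zero coefficients are
    skipped because they would still contribute their index. *)
Definition poly_degree (R : idomainType) (dg : R -> nat) (f : {poly R}) : nat :=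
  \max_(i < size f | (f`_i)%R != 0%R) (dg (f`_i)%R + i)%N.

Section Degree.
Variables (R : idomainType) (dg : R -> nat).
Hypothesis dgP : factorial_degree dg.

Lemma degree1 : dg 1 = 0%N.
Proof. by have := @degreeM _ _ dgP 1 1 (oner_neq0 _) (oner_neq0 _); rewrite mulr1; lia. Qed.

Lemma degreeN x : dg (- x) = dg x.
Proof.
have [->|x0] := eqVneq x 0; first by rewrite oppr0.
have dN1 : dg (-1) = 0%N.
  have := degreeM dgP (_ : -1 != 0) (_ : -1 != 0).
  by rewrite mulrNN mulr1 degree1 oppr_eq0 oner_eq0 => /(_ isT isT); lia.
by rewrite -mulN1r (degreeM dgP) ?dN1 // oppr_eq0 oner_eq0.
Qed.

Lemma degreeDr x y : (dg x < dg y)%N -> dg (x + y) = dg y.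
Proof.
move=> ltxy; have := degreeD dgP x y.
by have := degreeD dgP (- x) (x + y); rewrite addKr degreeN; lia.
Qed.

Lemma degree_sum (I : eqType) (r : seq I) (P : pred I) (F : I -> R) n :
  (forall i, i \in r -> P i -> (dg (F i) <= n)%N) -> (dg (\sum_(i <- r | P i) F i)%R <= n)%N.
Proof.
move=> leF; rewrite big_seq_cond; elim/big_ind: _ => [|x y|i /andP[]]; last exact: leF.
  by rewrite degree0.
by move=> lx ly; rewrite (leq_trans (degreeD dgP _ _)) // geq_max lx.
Qed.

Lemma degreeM_le x y : (dg (x * y)%R <= dg x + dg y)%N.
Proof.
have [->|x0] := eqVneq x 0; first by rewrite mul0r degree0.
have [->|y0] := eqVneq y 0; first by rewrite mulr0 degree0.
by rewrite (degreeM dgP).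
Qed.

Lemma degreeMn x n : (dg (x *+ n)%R <= dg x)%N.
Proof.
elim: n => [|n IH]; first by rewrite mulr0n degree0.
by rewrite mulrS (leq_trans (degreeD dgP _ _)) // geq_max leqnn.
Qed.

Lemma irreducible_factor x : x != 0 -> (0 < dg x)%N ->
  exists2 y, degree_irreducible dg y & divides y x.
Proof.
have [n] := ubnP (dg x); elim: n x => // n IH x ltxn x0 dx.
have [[a [b [xE da db]]]|H] := pselect
    (exists a b, [/\ x = a * b, (0 < dg a)%N & (0 < dg b)%N]).
  have [a0 b0] : a != 0 /\ b != 0.
    by move: x0; rewrite xE mulf_eq0 negb_or => /andP[].
  have := degreeM dgP a0 b0; rewrite -xE => dE.
  have [|y yI [q aE]] := IH a _ a0 da; first by lia.
  by exists y => //; exists (b * q); rewrite xE aE; ring.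
exists x; last by exists 1; rewrite mul1r.
split=> // a b xE; have [] := posnP (dg a); first by left.
by have [] := posnP (dg b); [right | move=> db da; case: H; exists a, b].
Qed.
End Degree.

Lemma divides_sum (R : idomainType) (x : R) (I : Type) (r : seq I) (P : pred I) (F : I -> R) :
  (forall i, P i -> divides x (F i)) -> divides x (\sum_(i <- r | P i) F i).
Proof.
move=> dvF; elim/big_ind: _ => //; first by exists 0; rewrite mul0r.
by move=> _ _ [q ->] [q' ->]; exists (q + q'); rewrite mulrDl.
Qed.

Lemma dividesMr (R : idomainType) (x y z : R) : divides x y -> divides x (y * z).
Proof. by move=> [q ->]; exists (q * z); rewrite mulrAC. Qed.

Lemma dividesMl (R : idomainType) (x y z : R) : divides x y -> divides x (z * y).
Proof. by move=> [q ->]; exists (z * q); rewrite mulrA. Qed.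

Lemma divides_addl (R : idomainType) (x y z : R) :
  divides x (y + z) -> divides x z -> divides x y.
Proof. by move=> [q yzE] [q' zE]; exists (q - q'); rewrite mulrBl -yzE -zE addrK. Qed.

Lemma divides_polyC (R : idomainType) (x : R) (f : {poly R}) :
  (forall i, divides x f`_i) -> divides x%:P f.
Proof.
elim/poly_ind: f => [|f c IH] dv_f; first by exists 0; rewrite mul0r.
have [|q ->] := IH; first by move=> i; have := dv_f i.+1; rewrite coefD coefMX coefC /= addr0.
have [q0] := dv_f 0; rewrite coefD coefMX coefC /= add0r => ->.
by exists (q * 'X + q0%:P); rewrite mulrDl polyCM; ring.
Qed.

Lemma divides_coef (R : idomainType) (x : R) (f : {poly R}) i :
  divides x%:P f -> divides x f`_i.
Proof. by move=> [q ->]; exists q`_i; rewrite coefMC. Qed.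

(** * Gauss's lemma: factoriality of polynomial rings *)

Section Lift.
Variables (R : idomainType) (dg : R -> nat).
Hypothesis dgP : factorial_degree dg.
Local Notation pdg := (poly_degree dg).
Implicit Types f g h : {poly R}.

Lemma leq_poly_degree f i : f`_i != 0 -> (dg (f`_i)%R + i <= pdg f)%N.
Proof.
move=> fi; have lti : (i < size f)%N.
  by rewrite ltnNge; apply: contra fi => /(nth_default 0) ->.
exact: (@leq_bigmax_cond _ (fun i : 'I_(size f) => (f`_i)%R != 0) _ (Ordinal lti)).
Qed.

Lemma poly_degree_leP f n :
  (forall i, f`_i != 0 -> (dg (f`_i)%R + i <= n)%N) -> (pdg f <= n)%N.
Proof. by move=> le_n; apply/bigmax_leqP => i /le_n. Qed.

(** Of the coefficients of top total degree the one of largest index is chosen. This breaks ties as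
    a monomial order does, so that in a product the two chosen terms cannot be cancelled. *)
Lemma poly_degree_max f : f != 0 ->
  exists2 i, f`_i != 0 & forall j, f`_j != 0 ->
    (dg (f`_j)%R + j <= dg (f`_i)%R + i)%N /\
    (i < j -> dg (f`_j)%R + j < dg (f`_i)%R + i)%N.
Proof.
move=> f0; pose P i := (f`_i != 0) && (dg (f`_i)%R + i == pdg f)%N.
have exP : exists i, P i.
  have lts : ((size f).-1 < size f)%N by rewrite prednK ?size_poly_gt0.
  have [|i fi dE] := @eq_bigmax_cond 'I_(size f) [pred i : 'I_(size f) | (f`_i)%R != 0]
      (fun i => dg (f`_i)%R + i)%N.
    by apply/card_gt0P; exists (Ordinal lts); rewrite inE /= -lead_coefE lead_coef_eq0.
  by move: fi; rewrite inE => fi; exists i; rewrite /P fi /= /poly_degree -dE.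
have leP i : P i -> (i <= pdg f)%N by case/andP => _ /eqP <-; rewrite leq_addl.
have [i /andP[fi /eqP dE] maxi] := ex_maxnP exP leP.
exists i => // j fj; have ltj := leq_poly_degree fj; split; first by rewrite dE.
move=> ltij; rewrite ltn_neqAle dE ltj andbT; apply/negP => /eqP dj.
by have := maxi j; rewrite /P fj dj eqxx leqNgt ltij => /(_ isT).
Qed.
Lemma poly_degreeD f g : (pdg (f + g)%R <= maxn (pdg f) (pdg g))%N.
Proof.
apply: poly_degree_leP => i; rewrite coefD.
have [->|fi] := eqVneq f`_i 0.
  by rewrite add0r => /leq_poly_degree H; rewrite (leq_trans H) ?leq_maxr.
have [->|gi] := eqVneq g`_i 0.
  by rewrite addr0 => _; rewrite (leq_trans (leq_poly_degree fi)) ?leq_maxl.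
move=> _; apply: leq_trans (leq_add (degreeD dgP _ _) (leqnn i)) _.
by have := leq_poly_degree fi; have := leq_poly_degree gi; lia.
Qed.

Lemma poly_degree0 : pdg 0 = 0%N.
Proof. by rewrite /poly_degree size_poly0 big_ord0. Qed.

Lemma poly_degreeM f g : f != 0 -> g != 0 -> pdg (f * g)%R = (pdg f + pdg g)%N.
Proof.
move=> f0 g0; apply/eqP; rewrite eqn_leq; apply/andP; split.
  apply: poly_degree_leP => k fgk.
  have lek : (k <= pdg f + pdg g)%N.
    have ltk : (k < size (f * g)%R)%N.
      by rewrite ltnNge; apply: contra fgk => /(nth_default 0) ->.
    have := leq_poly_degree (_ : f`_(size f).-1 != 0).
    have := leq_poly_degree (_ : g`_(size g).-1 != 0).
    rewrite -!lead_coefE !lead_coef_eq0 => /(_ g0) + /(_ f0).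
    by move: ltk; rewrite size_mul //; lia.
  have: (dg (\sum_(i < k.+1) f`_i * g`_(k - i))%R <= pdg f + pdg g - k)%N.
    apply: (degree_sum dgP) => i _ _.
    have [->|fi] := eqVneq f`_i 0; first by rewrite mul0r (degree0 dgP).
    have [->|gi] := eqVneq g`_(k - i) 0; first by rewrite mulr0 (degree0 dgP).
    have := leq_poly_degree fi; have := leq_poly_degree gi.
    by rewrite (degreeM dgP) //; have := ltn_ord i; lia.
  by rewrite -coefM; lia.
have [i fi maxf] := poly_degree_max f0; have [j gj maxg] := poly_degree_max g0.
have df : (pdg f <= dg (f`_i)%R + i)%N by apply: poly_degree_leP => ? /maxf[].
have dgj : (pdg g <= dg (g`_j)%R + j)%N by apply: poly_degree_leP => ? /maxg[].
have lti : (i < (i + j).+1)%N by rewrite ltnS leq_addr.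
set m := dg (f`_i * g`_j).
have mE : m = (dg (f`_i)%R + dg (g`_j)%R)%N by rewrite /m (degreeM dgP).
pose S := \sum_(k < (i + j).+1 | k != Ordinal lti) f`_k * g`_(i + j - k).
have fgE : (f * g)`_(i + j) = S + f`_i * g`_j.
  by rewrite coefM (bigD1 (Ordinal lti)) //= addKn addrC.
(* An index other than [i] either exceeds [i] or leaves an index above [j] to [g]; in both cases the
   tie-break gives a strict inequality. *)
have ltF (k : 'I_(i + j).+1) : k != Ordinal lti -> f`_k * g`_(i + j - k) != 0 ->
    (dg (f`_k * g`_(i + j - k))%R < m)%N.
  rewrite mulf_eq0 negb_or -val_eqE /= => neqk /andP[fk gk].
  rewrite (degreeM dgP) // mE; have [lef ltf] := maxf _ fk; have [leg ltg] := maxg _ gk.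
  have lek := ltn_ord k.
  move: lef ltf leg ltg; move: (dg f`_k) (dg f`_i) (dg g`_j) (dg g`_(i + j - k)) => *.
  by case: (ltngtP k i) neqk => // H _; lia.
have fg0 : (f * g)`_(i + j) != 0 /\ dg ((f * g)`_(i + j)) = m.
  (* Zero has degree 0 too, so for [m = 0] degrees cannot separate the terms; there the strict
     inequality forces all other terms to vanish. *)
  case: (posnP m) => [m0|m0].
    have S0 : S = 0.
      by apply: big1 => k kn; apply/eqP/negPn/negP => /(ltF _ kn); rewrite m0.
    by rewrite fgE S0 add0r mulf_neq0.
  have ltS : (dg S < m)%N.
    rewrite -(prednK m0) ltnS; apply: (degree_sum dgP) => k _ kn.
    have [->|nz] := eqVneq (f`_k * g`_(i + j - k)) 0; first by rewrite (degree0 dgP).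
    by rewrite -ltnS prednK // ltF.
  have dE : dg ((f * g)`_(i + j)) = m by rewrite fgE (degreeDr dgP).
  by split=> //; apply: contraTneq m0 => E; rewrite -dE E (degree0 dgP).
by have := leq_poly_degree fg0.1; rewrite fg0.2 mE; lia.
Qed.

Lemma poly_degree_unit f : f != 0 -> pdg f = 0%N -> f \is a GRing.unit.
Proof.
move=> f0 df; have lc0 : lead_coef f != 0 by rewrite lead_coef_eq0.
have := leq_poly_degree lc0; rewrite df leqn0 addn_eq0 => /andP[/eqP dl /eqP s0].
have sf : size f = 1%N by move: f0 s0; rewrite -size_poly_gt0; lia.
by rewrite poly_unitE sf eqxx (_ : f`_0 = lead_coef f) ?(degree_unit dgP) // lead_coefE s0.
Qed.

Lemma poly_degreeC x : pdg x%:P = dg x.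
Proof.
have [->|x0] := eqVneq x 0; first by rewrite poly_degree0 (degree0 dgP).
apply/eqP; rewrite eqn_leq; apply/andP; split.
  apply: poly_degree_leP => i; rewrite coefC.
  by case: (i =P 0%N) => [->|_]; rewrite ?addn0 ?eqxx.
by have := @leq_poly_degree x%:P 0; rewrite coefC /= addn0; apply.
Qed.

(** Gauss's argument: if [i] and [j] are the least indices of coefficients of [f] and [g] not
    divisible by [x], then in the coefficient of index [i + j] of the product every other term is
    divisible by [x]. *)
Lemma polyC_prime x f g : degree_irreducible dg x ->
  divides x%:P (f * g) -> divides x%:P f \/ divides x%:P g.
Proof.
move=> xI dvfg; apply: contrapT => /not_orP[ndf ndg].
have min_coef h : ~ divides x%:P h ->
    exists2 i, ~ divides x h`_i & forall j, (j < i)%N -> divides x h`_j.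
  move=> ndh; have exi : exists i, `[< ~ divides x h`_i >].
    apply: contrapT => H; apply: ndh; apply: divides_polyC => i; apply: contrapT => ndi.
    by apply: H; exists i; apply/asboolP.
  have [i /asboolP ndi mini] := ex_minnP exi; exists i => // j ltji.
  by apply: contrapT => ndj; have := mini j; rewrite leqNgt ltji => /(_ (asboolT ndj)).
have [i ndi mini] := min_coef f ndf; have [j ndj minj] := min_coef g ndg.
have lti : (i < (i + j).+1)%N by rewrite ltnS leq_addr.
have := divides_coef (i + j) dvfg; rewrite coefM (bigD1 (Ordinal lti)) //= addKn.
move=> /divides_addl dvE.
suff /dvE/(irreducible_prime dgP xI)[]: divides x
  (\sum_(k < (i + j).+1 | k != Ordinal lti) f`_k * g`_(i + j - k)) by [].
apply: divides_sum => k; rewrite -val_eqE /= => neqk; have := ltn_ord k.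
case: (ltngtP k i) neqk => // ltk _ lek; first exact/dividesMr/mini.
by apply/dividesMl/minj; lia.
Qed.

(** An irreducible factor of [x] stays prime among polynomials, so it divides [g] or [h] and can be
    cancelled there; a unit is absorbed at the end. *)
Lemma scale_factor x f g h : x != 0 -> x *: f = g * h ->
  exists y z g' h', [/\ f = g' * h', g = y *: g' & h = z *: h'].
Proof.
have [n] := ubnP (dg x); elim: n x f g h => // n IH x f g h ltxn x0 E.
have [dx|dx] := posnP (dg x).
  have xU := degree_unit dgP x0 dx.
  exists x, 1, (x^-1 *: g), h; split; rewrite ?scale1r ?scalerA ?mulrV ?scale1r //.
  by rewrite -scalerAl -E scalerA mulVr ?scale1r.
have [y yI [q xE]] := irreducible_factor dgP x0 dx.
have [q0 y0] : q != 0 /\ y != 0 by move: x0; rewrite xE mulf_eq0 negb_or => /andP[].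
have ltq : (dg q < n)%N.
  by case: yI => _ dy _; move: ltxn; rewrite xE (degreeM dgP) //; lia.
have yP0 : y%:P != 0 by rewrite polyC_eq0.
have dv : divides y%:P (g * h).
  by exists (q *: f); rewrite -E xE -!mul_polyC polyCM; ring.
have [[g1 gE]|[h1 hE]] := polyC_prime yI dv.
  have E1 : q *: f = g1 * h.
    by apply: (mulIf yP0); rewrite mulrAC -gE -E xE -!mul_polyC polyCM; ring.
  have [a [b [g' [h' [fE g1E hE]]]]] := IH _ _ _ _ ltq q0 E1.
  exists (y * a), b, g', h'; split=> //.
  by rewrite gE g1E -!mul_polyC polyCM; ring.
have E1 : q *: f = g * h1.
  by apply: (mulIf yP0); rewrite -mulrA -hE -E xE -!mul_polyC polyCM; ring.
have [a [b [g' [h' [fE gE h1E]]]]] := IH _ _ _ _ ltq q0 E1.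
exists a, (y * b), g', h'; split=> //.
by rewrite hE h1E -!mul_polyC polyCM; ring.
Qed.

(** Divisibility over the fraction field descends to the ring: clearing [x] splits [f] as a scalar
    times a polynomial, and since [f] is irreducible and not constant the scalar is a unit. *)
Lemma irreducible_scale_dvd f g x h :
  degree_irreducible pdg f -> (1 < size f)%N -> x != 0 -> x *: g = h * f -> divides f g.
Proof.
move=> [f0 df irrf] sf x0 /(scale_factor x0) [y [z [h' [f' [-> _ fE]]]]].
have [z0 f'0] : z != 0 /\ f' != 0.
  by move: f0; rewrite fE -mul_polyC mulf_eq0 polyC_eq0 negb_or => /andP[].
have [|d0|d0] := irrf z%:P f'; first by rewrite fE mul_polyC.
  have zU : z \is a GRing.unit by apply: (degree_unit dgP) => //; rewrite -poly_degreeC.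
  exists (z^-1 *: h'); rewrite fE -scalerAr -scalerAl scalerA mulrV ?scale1r //.
have := poly_degree_unit f'0 d0; rewrite poly_unitE => /andP[/eqP sf' _].
by move: sf; rewrite fE size_scale // sf'.
Qed.

(** The [gcdp] divides only up to scalars. Once these are cleared, a non-constant gcd is [f] up to a
    unit and a scalar. *)
Lemma irreducible_dvd_or_coprime f g :
  degree_irreducible pdg f -> (1 < size f)%N -> divides f g \/ (size (gcdp f g) <= 1)%N.
Proof.
move=> fI sf; have [f0 df irrf] := fI; case: leqP => [|sd]; [by right | left].
have /Pdiv.Idomain.dvdpP[[x q] /= x0 fE] := dvdp_gcdl f g.
have /Pdiv.Idomain.dvdpP[[y r] /= y0 gE] := dvdp_gcdr f g.
have [a [b [q' [d' [f'E _ dE]]]]] := scale_factor x0 fE.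
have [q'0 d'0] : q' != 0 /\ d' != 0.
  by move: f0; rewrite f'E mulf_eq0 negb_or => /andP[].
have b0 : b != 0 by apply: contraTneq sd => b0; rewrite dE b0 scale0r size_poly0.
have q'U : q' \is a GRing.unit.
  have [d0|d0] := irrf _ _ f'E; first exact: poly_degree_unit.
  have := poly_degree_unit d'0 d0; rewrite poly_unitE => /andP[/eqP sd' _].
  by move: sd; rewrite dE size_scale // sd'.
apply: (irreducible_scale_dvd fI sf y0 (h := b *: (r * q'^-1))).
by rewrite gE dE f'E -!mul_polyC -!mulrA mulKr //; ring.
Qed.

(** For a constant irreducible this is [polyC_prime]. Otherwise, if [f] does not divide [g], a
    Bezout relation [u f + v g = x] with a nonzero scalar [x] makes [x h] a multiple of [f]. *)
Theorem poly_degree_factorial : factorial_degree pdg.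
Proof.
split; [exact: poly_degree0 | exact: poly_degreeD | exact: poly_degreeM
  | exact: poly_degree_unit |].
move=> f g h fI [q ghE]; have [f0 df irrf] := fI.
have [sf|sf] := leqP (size f) 1.
  move: fI ghE; rewrite [f]size1_polyC //; move: f`_0 => x xI ghE.
  apply: polyC_prime; last by exists q.
  case: xI; rewrite polyC_eq0 poly_degreeC => x0 dx irrx; split=> // a b E.
  by rewrite -!poly_degreeC; apply: irrx; rewrite E polyCM.
have [|cop] := irreducible_dvd_or_coprime g fI sf; [by left | right].
have [[u v] /= uvE] := Bezoutp f g.
have : size (u * f + v * g) = 1%N.
  rewrite (eqp_size uvE); apply/eqP; rewrite eqn_leq cop size_poly_gt0 gcdp_eq0.
  by rewrite (negPf f0).
move/eqP/size_poly1P => [x x0 E].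
apply: (irreducible_scale_dvd fI sf x0 (h := u * h + v * q)).
by rewrite -mul_polyC -E mulrDl -(mulrA v) ghE; ring.
Qed.

End Lift.

Lemma field_degree_factorial (K : fieldType) : factorial_degree (fun _ : K => 0%N).
Proof. by split=> // [x x0 _|x a b []//]; rewrite unitfE. Qed.

(** * Evaluation and elimination *)

Section Evaluation.
Variables R S : comNzRingType.
Implicit Types (phi : {rmorphism R -> S}) (f : {poly R}).

Definition eval_poly phi (y : S) : {rmorphism {poly R} -> S} :=
  horner_eval y \o map_poly phi.

Lemma eval_polyE phi y f : eval_poly phi y f = \sum_(i < size f) phi f`_i * y ^+ i.
Proof.
rewrite /eval_poly /= /horner_eval (horner_coef_wide _ (size_poly _ _)).
by apply: eq_bigr => i _; rewrite coef_map.
Qed.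

Lemma eval_polyC phi y x : eval_poly phi y x%:P = phi x.
Proof. by rewrite /eval_poly /= /horner_eval map_polyC hornerC. Qed.

Lemma eval_polyX phi y : eval_poly phi y 'X = y.
Proof. by rewrite /eval_poly /= /horner_eval map_polyX hornerX. Qed.

End Evaluation.

Lemma rmorph_eval_poly (R S U : comNzRingType) (psi : {rmorphism S -> U})
    (phi : {rmorphism R -> S}) (phi' : {rmorphism R -> U}) y f :
  (forall x, psi (phi x) = phi' x) -> psi (eval_poly phi y f) = eval_poly phi' (psi y) f.
Proof.
move=> E; rewrite !eval_polyE rmorph_sum; apply: eq_bigr => i _.
by rewrite rmorphM rmorphXn E.
Qed.
Section LineEvaluation.
Variables (R : idomainType) (S : idomainType) (phi : {rmorphism R -> {poly S}}) (y : {poly S}).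

Lemma size_eval_poly (dg : R -> nat) f :
  (forall x, (size (phi x) <= (dg x).+1)%N) -> (size y <= 2)%N ->
  (size (eval_poly phi y f) <= (poly_degree dg f).+1)%N.
Proof.
move=> le_phi le_y; rewrite eval_polyE; apply: (leq_trans (size_sum _ _ _)).
apply/bigmax_leqP => i _; have [->|fi] := eqVneq f`_i 0.
  by rewrite rmorph0 mul0r size_poly0.
have lex : (size (y ^+ i) <= i.+1)%N.
  apply: (leq_trans (size_poly_exp_leq _ _)); rewrite ltnS -{2}[nat_of_ord i]mul1n leq_mul2r.
  by apply/orP; right; lia.
apply: (leq_trans (size_polyMleq _ _)); move: (leq_poly_degree dg fi) (le_phi f`_i) lex.
by move: (size (phi f`_i)) (dg f`_i) (size (y ^+ i)) => *; lia.
Qed.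

(** Chain rule: [del] accounts for the inner variables, the last term for the outer one. *)
Lemma deriv_eval_poly (del : R -> R) f : del 0 = 0 ->
  (forall x, (phi x)^`() = phi (del x)) ->
  (eval_poly phi y f)^`() = eval_poly phi y (map_poly del f) + y^`() * eval_poly phi y f^`().
Proof.
move=> del0 phi_del; elim/poly_ind: f => [|f x IH].
  by rewrite map_poly0 deriv0 !rmorph0 mulr0 addr0 deriv0.
have -> : map_poly del (f * 'X + x%:P) = map_poly del f * 'X + (del x)%:P.
  apply/polyP => i; rewrite coef_map_id0 // !coefD !coefMX !coefC.
  by case: i => [|i] /=; rewrite ?add0r // !addr0 coef_map_id0.
rewrite derivD derivM derivX derivC mulr1 addr0 !rmorphD !rmorphM.
rewrite !(eval_polyC, eval_polyX) derivD derivM IH phi_del; ring.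
Qed.
End LineEvaluation.

Lemma size_det_leq (R : comNzRingType) n (M : 'M[{poly R}]_n) (r : 'I_n -> nat) :
  (forall i j, size (M i j) <= (r i).+1)%N -> (size (\det M) <= (\sum_i r i).+1)%N.
Proof.
move=> leM; rewrite /determinant; apply: (leq_trans (size_sum _ _ _)).
apply/bigmax_leqP => s _.
rewrite mulr_sign (fun_if (fun p : {poly R} => size p)) size_polyN if_same.
apply: (leq_trans (size_poly_prod_leq _ _)).
have : (\sum_i size (M i (fun_of_perm s i)) <= \sum_(i < n) (r i).+1)%N by apply: leq_sum => i _.
under [X in (_ <= X)%N -> _]eq_bigr do rewrite -addn1.
by rewrite big_split /= sum1_card leq_subLR addnS ltnS addnC.
Qed.

Lemma size_resultant_leq (R : comNzRingType) (f g : {poly {poly R}}) m n :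
  (forall i, size (f`_i)%R <= m.+1)%N -> (forall i, size (g`_i)%R <= n.+1)%N ->
  (size (resultant f g) <= ((size g).-1 * m + (size f).-1 * n).+1)%N.
Proof.
move=> lef leg; pose r (i : 'I_((size g).-1 + (size f).-1)) := if split i is inl _ then m else n.
apply: (leq_trans (size_det_leq (r := r) _)).
  move=> i j; rewrite Sylvester_mxE /r; case: (split i) => k /=;
    by case: (k <= j)%N; rewrite ?mulr1n // mulr0n size_poly0.
rewrite ltnS big_split_ord /=.
under eq_bigr => i _ do rewrite /r (unsplitK (inl i)).
under [X in (_ + X)%N]eq_bigr => i _ do rewrite /r (unsplitK (inr i)).
by rewrite !sum_nat_const !card_ord.
Qed.

(** * Total degree and elimination in three variables *)

Section Trivariate.
Variable K : fieldType.
Local Notation K2 := {poly {poly K}}.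
Local Notation K3 := {poly {poly {poly K}}}.
Definition total_degree2 : K2 -> nat := poly_degree (poly_degree (fun _ : K => 0%N)).
Definition total_degree : K3 -> nat := poly_degree total_degree2.
Local Notation D2 := total_degree2.
Local Notation D := total_degree.

Lemma total_degree2P : factorial_degree D2.
Proof. by do 2!apply: poly_degree_factorial; apply: field_degree_factorial. Qed.

Lemma total_degreeP : factorial_degree D.
Proof. by apply: poly_degree_factorial; apply: total_degree2P. Qed.

Lemma size_poly_degree (R : idomainType) (dg : R -> nat) (f : {poly R}) :
  (size f <= (poly_degree dg f).+1)%N.
Proof.
have [->|f0] := eqVneq f 0; first by rewrite size_poly0.
have := @leq_poly_degree _ dg f (size f).-1.
by rewrite -lead_coefE lead_coef_eq0 => /(_ f0); lia.
Qed.

Lemma size_coef_total_degree (f : K3) i : (size (f`_i)%R <= (D f).+1)%N.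
Proof.
have [->|fi] := eqVneq f`_i 0; first by rewrite size_poly0.
have := leq_poly_degree D2 fi; rewrite -/(D f).
have := size_poly_degree (poly_degree (fun _ : K => 0%N)) f`_i; rewrite -/(D2 _).
by move: (size f`_i) (D2 f`_i) (D f) => *; lia.
Qed.

(** The resultant in the outer variable serves as [c]; it is nonzero because [f] and [g] are
    coprime. If that variable is absent from [g], then [g] itself is [c]. *)
Lemma irreducible_elimination (f g : K3) :
  degree_irreducible D f -> (1 < size f)%N -> ~ divides f g ->
  exists c a b, [/\ c != 0, c%:P = a * f + b * g & (size c <= (2 * D f * D g).+1)%N].
Proof.
move=> fI sf ndvd; have [f0 df _] := fI.
have g0 : g != 0 by apply/eqP => g0; apply: ndvd; exists 0; rewrite g0 mul0r.
have [sg|sg] := leqP (size g) 1.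
  have gE := size1_polyC sg; exists g`_0, 0, 1; split.
  - by apply: contraNneq g0 => E; rewrite gE E.
  - have E (S : comNzRingType) (x y : S) : y = 0 * x + 1 * y by rewrite mul0r add0r mul1r.
    exact: etrans (esym gE) (E _ f g).
  - by apply: (leq_trans (size_coef_total_degree g 0)); rewrite ltnS leq_pmull; lia.
have [[a b] _ resE] := resultant_in_ideal sf sg.
exists (resultant f g), a, b; split=> //.
  rewrite resultant_eq0 -leqNgt.
  by have [//|] := irreducible_dvd_or_coprime total_degree2P g fI sf.
have lef := size_coef_total_degree f; have leg := size_coef_total_degree g.
apply: leq_trans (size_resultant_leq lef leg) _; rewrite ltnS.
have := size_poly_degree D2 f; have := size_poly_degree D2 g; rewrite -/(D _) -/(D _).
by move: (size f) (size g) (D f) (D g) => *; nia.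
Qed.
End Trivariate.

(** * Curvature of plane curves *)

Definition deriv_inner (R : comNzRingType) (f : {poly {poly R}}) : {poly {poly R}} :=
  map_poly (@deriv R) f.

Lemma coef_deriv_inner (R : comNzRingType) (f : {poly {poly R}}) i :
  (deriv_inner f)`_i = (f`_i)^`().
Proof. by rewrite coef_map_id0 // deriv0. Qed.

Lemma deriv_innerC (R : comNzRingType) (f : {poly {poly R}}) :
  (deriv_inner f)^`() = deriv_inner f^`().
Proof. by apply/polyP => i; rewrite !(coef_deriv, coef_deriv_inner) derivMn. Qed.

(* The second fundamental form of the curve [f = 0] in its tangent direction. *)
Definition curvature (R : comNzRingType) (f : {poly {poly R}}) : {poly {poly R}} :=
  deriv_inner (deriv_inner f) * f^`() ^+ 2
  - deriv_inner f^`() * deriv_inner f * f^`() *+ 2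
  + f^`()^`() * deriv_inner f ^+ 2.

Lemma deriv_mul_exp (R : comNzRingType) (g X : {poly R}) k : X^`() = 1 ->
  (g * X ^+ k.+1)^`() = X ^+ k * (g *+ k.+1 + X * g^`()).
Proof.
move=> X'; rewrite derivM deriv_exp X' /= exprS -mulr_natl -!(mulr_natl g).
by move: (X ^+ k) => Y; rewrite -mulr_natl; ring.
Qed.

Section Curvature.
Variables (R S : idomainType) (phi : {rmorphism R -> {poly S}}) (y : {poly S}).
Hypotheses (phi' : forall x, (phi x)^`() = 0) (y'' : y^`()^`() = 0).
Local Notation ev := (eval_poly (eval_poly phi 'X) y).

Lemma deriv_on_line f : (ev f)^`() = ev (deriv_inner f) + y^`() * ev f^`().
Proof.
apply: deriv_eval_poly => [|x]; first by rewrite deriv0.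
rewrite (@deriv_eval_poly _ _ _ _ (fun _ => 0 : R)) // => [|z]; last by rewrite rmorph0.
have -> : map_poly (fun _ : R => 0 : R) x = 0 by apply/polyP => i; rewrite coef_map_id0 ?coef0.
by rewrite rmorph0 add0r derivX mul1r.
Qed.

(** On a line [y'' = 0], so the second derivative of [ev f] is quadratic in [y']. Multiply it by the
    square of the outer derivative of [f] and replace [y'] times that derivative by [(ev f)'] minus
    the inner one. *)
Lemma curvature_on_line f : exists q,
  ev (curvature f) = ev f^`() ^+ 2 * (ev f)^`()^`() + (ev f)^`() * q.
Proof.
exists (ev f^`()^`() * (ev (deriv_inner f) - y^`() * ev f^`())
        - ev (deriv_inner f^`()) * ev f^`() *+ 2).
rewrite /curvature !(deriv_on_line, derivD, derivM) y'' mul0r add0r deriv_innerC.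
rewrite !(rmorphD, rmorphN, rmorphMn, rmorphM).
move: (ev (deriv_inner (deriv_inner f))) (ev (deriv_inner f^`())) (ev f^`()^`()).
by move: (ev (deriv_inner f)) (ev f^`()) y^`() => a b c d e g; ring.
Qed.

Lemma curvature_eq0 f : ev f = 0 -> ev (curvature f) = 0.
Proof. by move=> f0; have [q ->] := curvature_on_line f; rewrite f0 !deriv0 mulr0 mul0r addr0. Qed.

(** A tangent line at a smooth point of a curve without curvature lies on the curve. Otherwise
    [ev f] vanishes at [x] to some order [k + 2]; in the identity of [curvature_on_line] the term
    with the second derivative has order exactly [k], all others a larger one. *)
Lemma flat_line f x d : divides f (curvature f) ->
  (ev f).[x] = 0 -> (ev f)^`().[x] = 0 -> (ev f^`()).[x] != 0 ->
  (size (ev f) <= d.+1)%N -> (forall n, (0 < n <= d)%N -> n%:R != 0 :> S) -> ev f = 0.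
Proof.
move=> [q curvE] fx f'x fZx sz pchar; apply: contraTeq isT => h0.
have [q' curvE'] := curvature_on_line f.
move: curvE'; rewrite curvE rmorphM; set h := ev f in fx f'x sz h0 *.
have [k [g ngx hE]] := multiplicity_XsubC h x.
rewrite h0 /= in ngx; move: fx f'x; rewrite hE.
case: k hE => [|[|k]] hE.
- by move/eqP; rewrite mulr1 -/(root g x) (negPf ngx).
- rewrite expr1 derivM derivXsubC mulr1 hornerD !hornerM hornerXsubC subrr !mulr0 add0r => _ /eqP.
  by rewrite -/(root g x) (negPf ngx).
move=> _ _; set Z := ev f^`(); set X := 'X - x%:P => E.
have X0 : X != 0 by rewrite polyXsubC_eq0.
have szk : (k.+2 <= d)%N.
  have g0 : g != 0 by apply: contraNneq ngx => ->; rewrite root0.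
  move: sz; rewrite hE size_Mmonic ?monic_exp ?monicXsubC // size_exp_XsubC.
  by move: g0; rewrite -size_poly_gt0; case: (size g) => //= n _; lia.
have X' : X^`() = 1 by rewrite derivXsubC.
pose u := g *+ k.+2 + X * g^`().
have h'E : (g * X ^+ k.+2)^`() = u * X ^+ k.+1 by rewrite deriv_mul_exp // mulrC.
have h''E : (g * X ^+ k.+2)^`()^`() = X ^+ k * (u *+ k.+1 + X * u^`()).
  by rewrite h'E deriv_mul_exp.
(* After division by [X ^+ k], evaluation at [x] leaves only [(k + 1) (k + 2) g(x) Z(x)^2], and
   neither integer vanishes since [k + 2 <= d]. *)
have E2 : ev q * (g * X ^+ 2) = Z ^+ 2 * (u *+ k.+1 + X * u^`()) + X * (u * q').
  apply: (mulfI (expf_neq0 k X0)); move: E; rewrite h''E h'E !exprS expr0 => E.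
  by rewrite mulrDr mulrCA [X ^+ k * (g * _)]mulrCA; move: E; rewrite !mulrA; move=> E; ring: E.
have Xx : X.[x] = 0 by rewrite hornerXsubC subrr.
have ux : u.[x] = g.[x] *+ k.+2 by rewrite hornerD hornerM Xx mul0r addr0 hornerMn.
clearbody X u; have := congr1 (horner^~ x) E2.
rewrite !(hornerD, hornerM, horner_exp, hornerMn) Xx ux !(mul0r, mulr0) => /esym/eqP.
have k1 : k.+1%:R != 0 :> S by apply: pchar; lia.
have k2 : k.+2%:R != 0 :> S by apply: pchar; lia.
rewrite !addr0 -(mulr_natr (_ *+ _)) -(mulr_natr g.[x]); move: k1 k2.
move: (k.+1%:R) (k.+2%:R) => a b a0 b0.
by rewrite !mulf_eq0 (negPf fZx) (negPf a0) (negPf b0) -/(root g x) (negPf ngx).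
Qed.
End Curvature.

(** * Red and blue lines *)

Lemma poly_degree_deriv (R : idomainType) (dg : R -> nat) (f : {poly R}) :
  factorial_degree dg -> (poly_degree dg f^`() <= poly_degree dg f)%N.
Proof.
move=> dgP; apply: poly_degree_leP => i; rewrite coef_deriv => fi.
have fi0 : f`_i.+1 != 0 by apply: contraNneq fi => ->; rewrite mul0rn.
apply: leq_trans (leq_poly_degree dg fi0); apply: leq_add => //; exact: degreeMn.
Qed.

Lemma poly_degree_deriv_inner (R : idomainType) (dg : R -> nat) (f : {poly {poly R}}) :
  factorial_degree dg ->
  (poly_degree (poly_degree dg) (deriv_inner f) <= poly_degree (poly_degree dg) f)%N.
Proof.
move=> dgP; apply: poly_degree_leP => i; rewrite coef_deriv_inner => fi.
have fi0 : f`_i != 0 by apply: contraNneq fi => ->; rewrite deriv0.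
apply: leq_trans (leq_poly_degree _ fi0); apply: leq_add => //; exact: poly_degree_deriv.
Qed.

Lemma eval_poly_coef_map (R S : idomainType) (h : {rmorphism R -> S})
    (phi : {rmorphism R -> {poly S}}) f :
  (forall x, phi x = (h x)%:P) -> eval_poly phi 'X f = map_poly h f.
Proof.
move=> phiE; rewrite eval_polyE /map_poly poly_def; apply: eq_bigr => i _.
by rewrite phiE mul_polyC.
Qed.

Section Lines.
Variable K : fieldType.
Local Notation K2 := {poly {poly K}}.
Local Notation K3 := {poly {poly {poly K}}}.
Local Notation D := (@total_degree K).

(* With coordinates [u], [v], [Z] on 3-space (the variables of [K3], innermost
   first), a line stands either for the "red" line [u = plane],
   [Z = slope * v - shift] or for the "blue" line [v = plane], [Z = slope * u - shift]. *)
Local Notation line := (K * K * K)%type.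
Definition slope (l : line) := l.1.1.
Definition shift (l : line) := l.1.2.
Definition plane (l : line) := l.2.
Implicit Types (r b : line) (f g : K3) (G H : seq line).

(** The lines can meet only above [u = plane r], [v = plane b]; the two sides are their heights [Z]
    there. *)
Definition incident r b : bool :=
  slope r * plane b - shift r == slope b * plane r - shift b.

Definition restrict_red r : {rmorphism K3 -> {poly K}} :=
  eval_poly (eval_poly (eval_poly (@polyC K) (plane r)%:P) 'X)
    (slope r *: 'X - (shift r)%:P).

Definition restrict_blue b : {rmorphism K3 -> {poly K}} :=
  eval_poly (eval_poly (eval_poly (@polyC K) 'X) (plane b)%:P)
    (slope b *: 'X - (shift b)%:P).

(** Both sides are the value of [f] at the common point. *)
Lemma restrict_incident r b f : incident r b ->
  (restrict_red r f).[plane b] = (restrict_blue b f).[plane r].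
Proof.
move=> /eqP inc; rewrite -!/(horner_eval _ _).
have E3 x (yu yv yZ : {poly K}) h :
    horner_eval x (eval_poly (eval_poly (eval_poly (@polyC K) yu) yv) yZ h)
    = eval_poly (eval_poly (eval_poly idfun yu.[x]) yv.[x]) yZ.[x] h.
  by do 3!(apply: rmorph_eval_poly => ?); exact: hornerC.
rewrite !E3 !(hornerD, hornerN, hornerZ, hornerX, hornerC).
by rewrite inc.
Qed.

Lemma poly_degree_const x : poly_degree (fun _ : K => 0%N) x = (size x).-1.
Proof.
have [->|x0] := eqVneq x 0; first by rewrite poly_degree0 size_poly0.
apply/eqP; rewrite eqn_leq; apply/andP; split.
  apply: poly_degree_leP => i xi; have : (i < size x)%N by
    rewrite ltnNge; apply: contra xi => /(nth_default 0) ->.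
  by lia.
by have := leq_poly_degree (fun _ => 0%N) (_ : x`_(size x).-1 != 0);
  apply; rewrite -lead_coefE lead_coef_eq0.
Qed.

Lemma size_restrict_red r f : (size (restrict_red r f) <= (D f).+1)%N.
Proof.
apply: size_eval_poly => [y|]; last first.
  by rewrite (leq_trans (size_polyD _ _)) // size_polyN geq_max;
    rewrite (leq_trans (size_scale_leq _ _)) ?size_polyX // (leq_trans (size_polyC_leq1 _)).
apply: size_eval_poly => [z|]; last by rewrite size_polyX.
apply: size_eval_poly => [t|]; first exact: size_polyC_leq1.
by rewrite (leq_trans (size_polyC_leq1 _)).
Qed.

Lemma size_restrict_blue b f : (size (restrict_blue b f) <= (D f).+1)%N.
Proof.
apply: size_eval_poly => [y|]; last first.
  by rewrite (leq_trans (size_polyD _ _)) // size_polyN geq_max;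
    rewrite (leq_trans (size_scale_leq _ _)) ?size_polyX // (leq_trans (size_polyC_leq1 _)).
apply: size_eval_poly => [z|]; last by rewrite (leq_trans (size_polyC_leq1 _)).
apply: size_eval_poly => [t|]; first exact: size_polyC_leq1.
by rewrite size_polyX.
Qed.

Lemma max_roots (R : idomainType) (T : Type) (key : T -> R) (s : seq T) (q : {poly R}) :
  q != 0 -> uniq (map key s) -> all (fun x => root q (key x)) s -> (size s <= (size q).-1)%N.
Proof.
move=> q0 us rs; rewrite -(size_map key) -ltnS prednK ?size_poly_gt0 //.
by apply: max_poly_roots => //; rewrite all_map.
Qed.

Definition lines_in (restrict : line -> {rmorphism K3 -> {poly K}}) f G :=
  all (fun l => restrict l f == 0) G.

(** The red lines lie in distinct planes [u = plane r], so those meeting [b] give distinct roots of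
    [f] restricted to [b]. *)
Lemma count_incident f G b : uniq (map plane G) -> lines_in restrict_red f G ->
  restrict_blue b f != 0 -> (count (incident^~ b) G <= D f)%N.
Proof.
move=> uG Gf bf; rewrite -size_filter.
have uF : uniq (map plane (filter (incident^~ b) G)).
  by apply: subseq_uniq uG; apply/map_subseq/filter_subseq.
have := max_roots bf uF; have := size_restrict_blue b f.
suff -> : all (fun l => root (restrict_blue b f) (plane l)) (filter (incident^~ b) G).
  by move=> sz /(_ isT)/leq_trans; apply; rewrite -subn1 leq_subLR add1n.
apply/allP => r; rewrite mem_filter => /andP[inc rG].
by rewrite /root -(restrict_incident _ inc); move/allP/(_ r rG)/eqP: Gf => ->; rewrite horner0.
Qed.

Lemma restrict_blue_const b (c : K2) : restrict_blue b c%:P = c.[(plane b)%:P].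
Proof.
rewrite /restrict_blue eval_polyC eval_polyE horner_coef; apply: eq_bigr => i _.
by congr (_ * _); rewrite (@eval_poly_coef_map _ _ idfun) // map_poly_id.
Qed.

(** On a blue line [v] is constant, so the eliminant [c], seen as a polynomial in [v] over [K[u]],
    has the value [plane b] as a root for each [b] in [H]. *)
Lemma count_blue f g H : degree_irreducible D f -> (1 < size f)%N -> ~ divides f g ->
  uniq (map plane H) -> lines_in restrict_blue f H -> lines_in restrict_blue g H ->
  (size H <= 2 * D f * D g)%N.
Proof.
move=> fI sf ndvd uH Hf Hg; have [c [a [b [c0 cE sc]]]] := irreducible_elimination fI sf ndvd.
have := max_roots (key := fun l : line => (plane l)%:P) c0 (s := H).
have -> : all (fun l : line => root c (plane l)%:P) H.
  apply/allP => l lH; rewrite /root -restrict_blue_const cE rmorphD !rmorphM.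
  move/allP/(_ l lH)/eqP: Hf => ->; move/allP/(_ l lH)/eqP: Hg => ->.
  by rewrite !mulr0 addr0.
rewrite map_comp map_inj_uniq; last exact: polyC_inj.
by move=> /(_ uH isT)/leq_trans; apply; rewrite -subn1 leq_subLR add1n.
Qed.

Lemma total_degree_deriv f : (D f^`() <= D f)%N.
Proof. exact/poly_degree_deriv/total_degree2P. Qed.

Lemma total_degree_deriv_inner f : (D (deriv_inner f) <= D f)%N.
Proof. exact/poly_degree_deriv_inner/poly_degree_factorial/field_degree_factorial. Qed.

Lemma total_degree_curvature f : (D (curvature f) <= 3 * D f)%N.
Proof.
have DP := total_degreeP K; have leM := degreeM_le DP; have leD := degreeD DP.
have dZ := total_degree_deriv; have dv := total_degree_deriv_inner.
have bound3 x y z n : (D x <= n -> D y <= n -> D z <= n -> D (x * y * z)%R <= 3 * n)%N.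
  move=> lx ly lz; have -> : (3 * n = n + n + n)%N by lia.
  apply: (leq_trans (leM _ _)); apply: leq_add => //.
  by apply: (leq_trans (leM _ _)); apply: leq_add.
rewrite /curvature !expr2 !mulrA.
apply: (leq_trans (leD _ _)); rewrite geq_max; apply/andP; split.
  apply: (leq_trans (leD _ _)); rewrite geq_max (degreeN DP) //; apply/andP; split.
    by apply: bound3 => //; do 2?apply: (leq_trans (dv _)).
  apply: (leq_trans (degreeMn DP _ _)).
  by apply: bound3 => //; apply: (leq_trans (dv _)).
by apply: bound3 => //; do 2?apply: (leq_trans (dZ _)).
Qed.
End Lines.
Arguments slope {K} l.
Arguments shift {K} l.
Arguments plane {K} l.

(** * Surfaces whose plane sections have no curvature *)

Section Ruled.
Variable K : fieldType.
Local Notation K3 := {poly {poly {poly K}}}.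
Local Notation D := (@total_degree K).
Local Notation line := (K * K * K)%type.
Implicit Types (f g : K3) (G H : seq line).

(** Over a field [L] containing [K[u]], [f] is a curve in the variables [v] and [Z], and each blue
    line on [f] is a point of it. The tangent at the smooth point [b0] lies on the curve, so [f]
    divides the equation of that tangent and all the other points lie on it. *)
Lemma ruled_blue_lines_over (L : fieldType) (frac : {rmorphism {poly K} -> L}) f (b0 : line) :
  (forall x, (frac x == 0) = (x == 0)) ->
  degree_irreducible D f -> (1 < size f)%N -> divides f (curvature f) ->
  (forall n, (0 < n <= D f)%N -> n%:R != 0 :> K) ->
  restrict_blue b0 f = 0 -> restrict_blue b0 f^`() != 0 ->
  exists a c : {poly K}, c != 0 /\ forall b, restrict_blue b f = 0 ->
    c * ((slope b *: 'X - (shift b)%:P) - (slope b0 *: 'X - (shift b0)%:P))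
    = a * (plane b - plane b0)%:P.
Proof.
move=> frac_eq0 fI sf ruled pchar f0 c0.
set c := restrict_blue b0 f^`() in c0 *; set a := - restrict_blue b0 (deriv_inner f).
exists a, c; split=> //.
pose t0 : {poly K} := slope b0 *: 'X - (shift b0)%:P.
pose x0 : L := frac (plane b0)%:P; pose s : L := frac a / frac c.
have fc0 : frac c != 0 by rewrite frac_eq0.
(* The tangent at the point of [b0], with [v] as parameter; its slope [s] is minus the quotient of
   the two partial derivatives. *)
pose y : {poly L} := (frac t0)%:P + s *: ('X - x0%:P).
pose phi : {rmorphism {poly K} -> {poly L}} := @polyC L \o frac.
pose ev := eval_poly (eval_poly phi 'X) y.
have y' : y^`() = s%:P by rewrite derivD derivC add0r derivZ derivXsubC alg_polyC.
have evx0 h : (ev h).[x0] = frac (restrict_blue b0 h).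
  transitivity (eval_poly (eval_poly frac x0) (frac t0) h).
    rewrite -[LHS]/(horner_eval x0 _).
    have -> : frac t0 = horner_eval x0 y.
      by rewrite /horner_eval hornerD hornerC hornerZ hornerXsubC subrr mulr0 addr0.
    apply: rmorph_eval_poly => x.
    have -> : eval_poly frac x0 x = eval_poly frac (horner_eval x0 'X) x.
      by rewrite /horner_eval hornerX.
    by apply: rmorph_eval_poly => z; exact: hornerC.
  apply/esym; apply: rmorph_eval_poly => x; apply: rmorph_eval_poly => z.
  congr (frac _); rewrite (@eval_poly_coef_map _ _ idfun) // map_poly_id //.
have phi' x : (phi x)^`() = 0 by rewrite derivC.
have y'' : y^`()^`() = 0 by rewrite y' derivC.
have evf : ev f = 0.
  apply: (flat_line phi' y'' (x := x0) (d := D f) ruled).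
  - by rewrite evx0 f0 rmorph0.
  - rewrite (deriv_on_line y phi') hornerD hornerM y' hornerC.
    rewrite !evx0 -/c /s divfK // -rmorphD /a.
    by rewrite subrr rmorph0.
  - by rewrite evx0 frac_eq0.
  - apply: size_eval_poly => [x|]; last first.
      rewrite (leq_trans (size_polyD _ _)) // geq_max (leq_trans (size_polyC_leq1 _)) //=.
      by rewrite (leq_trans (size_scale_leq _ _)) // size_XsubC.
    apply: size_eval_poly => [z|]; last by rewrite size_polyX.
    exact: leq_trans (size_polyC_leq1 _) _.
  - move=> n /pchar; rewrite -(rmorph_nat frac) frac_eq0 -polyC1 -polyCMn polyC_eq0 //.
(* The equation of the tangent with the denominator of the slope cleared. *)
pose g : K3 := c%:P%:P * ('X - t0%:P%:P) - a%:P%:P * ('X%:P - (plane b0)%:P%:P%:P).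
have evC x : ev x%:P%:P = (frac x)%:P by rewrite /ev !eval_polyC.
have rmorph_lin (A B : comNzRingType) (h : {rmorphism A -> B}) u v w x z t :
    h (u * (v - w) - x * (z - t)) = h u * (h v - h w) - h x * (h z - h t).
  by rewrite rmorphB !rmorphM !rmorphB.
have evg : ev g = 0.
  rewrite [ev g]rmorph_lin !evC /ev eval_polyX eval_polyC eval_polyX.
  rewrite [in X in X - _]/y addrAC subrr add0r -mul_polyC mulrA -polyCM [frac c * s]mulrC /s divfK //.
  by rewrite subrr.
(* Otherwise a nonzero eliminant [d], free of [Z], would vanish along the tangent, on which [v] is a
   free parameter. *)
have dvd_fg : divides f g.
  apply: contrapT => ndvd.
  have [d [A [B [d0 dE _]]]] := irreducible_elimination fI sf ndvd.
  have : ev d%:P = 0 by rewrite dE rmorphD !rmorphM evf evg !mulr0 addr0.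
  rewrite /ev eval_polyC (@eval_poly_coef_map _ _ frac) //.
  by move/eqP; rewrite map_poly_eq0_id0 ?frac_eq0 ?lead_coef_eq0 // (negPf d0).
move=> b fb; have [q gE] := dvd_fg.
have : restrict_blue b g = 0 by rewrite gE rmorphM fb mulr0.
have bC x : restrict_blue b x%:P%:P = x.
  by rewrite restrict_blue_const hornerC.
pose rb := restrict_blue b; rewrite -/rb in bC *.
rewrite [rb g]rmorph_lin !bC restrict_blue_const hornerX.
have -> : rb 'X = slope b *: 'X - (shift b)%:P by exact: eval_polyX.
by rewrite polyCB => /eqP; rewrite subr_eq0 => /eqP.
Qed.

Lemma ruled_blue_lines f (b0 : line) :
  degree_irreducible D f -> (1 < size f)%N -> divides f (curvature f) ->
  (forall n, (0 < n <= D f)%N -> n%:R != 0 :> K) ->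
  restrict_blue b0 f = 0 -> restrict_blue b0 f^`() != 0 ->
  exists a c : {poly K}, c != 0 /\ forall b, restrict_blue b f = 0 ->
    c * ((slope b *: 'X - (shift b)%:P) - (slope b0 *: 'X - (shift b0)%:P))
    = a * (plane b - plane b0)%:P.
Proof. exact/(ruled_blue_lines_over (@tofrac_eq0 {poly K})). Qed.
End Ruled.

(** * Incidences of blue lines with red lines on a surface *)

Section Surface.
Variable K : fieldType.
Local Notation K3 := {poly {poly {poly K}}}.
Local Notation D := (@total_degree K).
Local Notation line := (K * K * K)%type.
Local Notation inc := (@incident K).
Implicit Types (f g : K3) (G H : seq line).

(** For lines in distinct planes this is collinearity of the points (slope, shift, plane). *)
Definition aligned (b0 b1 b2 : line) : Prop :=
  (slope b1 - slope b0) * (plane b2 - plane b0) = (slope b2 - slope b0) * (plane b1 - plane b0) /\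
  (shift b1 - shift b0) * (plane b2 - plane b0) = (shift b2 - shift b0) * (plane b1 - plane b0).

Definition max_aligned k H : Prop := forall S, uniq S -> {subset S <= H} ->
  {in S & &, forall b0 b1 b2, aligned b0 b1 b2} -> (size S <= k)%N.

(** The height of [b], a polynomial in [u], is affine in [plane b] with the same slope [a / c] for
    all [b]. Eliminate this slope and compare coefficients of [u]. *)
Lemma blue_lines_aligned (a c : {poly K}) (m b0 b1 b2 : line) : c != 0 ->
  {in [:: b0; b1; b2], forall b,
    c * ((slope b *: 'X - (shift b)%:P) - (slope m *: 'X - (shift m)%:P))
    = a * (plane b - plane m)%:P} ->
  aligned b0 b1 b2.
Proof.
move=> c0 rel; move: (rel b0) (rel b1) (rel b2); rewrite !inE !eqxx ?orbT.
move=> /(_ isT) r0 /(_ isT) r1 /(_ isT) r2.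
pose t b : {poly K} := slope b *: 'X - (shift b)%:P.
have E : (t b1 - t b0) * (plane b2 - plane b0)%:P = (t b2 - t b0) * (plane b1 - plane b0)%:P.
  apply: (mulfI c0); move: r0 r1 r2; rewrite -/(t _) -/(t _) -/(t b0) -/(t b1) -/(t b2).
  rewrite !polyCB; move: (t m) (t b0) (t b1) (t b2) (plane m)%:P (plane b0)%:P.
  move: (plane b1)%:P (plane b2)%:P => p1 p2 tm t0 t1 t2 pm p0 r0 r1 r2.
  have sub i j pi pj : c * (i - tm) = a * (pi - pm) -> c * (j - tm) = a * (pj - pm) ->
      c * (i - j) = a * (pi - pj).
    move=> ri rj; have -> : i - j = (i - tm) - (j - tm) by ring.
    by rewrite mulrBr ri rj; ring.
  by rewrite !mulrA (sub _ _ _ _ r1 r0) (sub _ _ _ _ r2 r0); ring.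
split.
  have := congr1 (fun p : {poly K} => p`_1) E.
  by rewrite !coefMC !coefB !coefZ !coefX !coefC /= !mulr1 !subr0.
have := congr1 (fun p : {poly K} => - p`_0) E.
rewrite !coefMC !coefB !coefZ !coefX !coefC /= !mulr0 !sub0r -!mulNr.
by rewrite !opprB !opprK ![- _ + _]addrC.
Qed.

Lemma max_aligned_sub k H H' : {subset H' <= H} -> max_aligned k H -> max_aligned k H'.
Proof. by move=> sub maxH S uS sS; apply: maxH => // b /sS/sub. Qed.

Lemma count_incident_sum (P : pred line) G H m :
  (forall b, b \in H -> P b -> count (inc^~ b) G <= m)%N ->
  (\sum_(b <- H | P b) count (inc^~ b) G <= m * count P H)%N.
Proof.
move=> le_m; rewrite mulnC -sum1_count big_distrl /= big_seq_cond [X in (_ <= X)%N]big_seq_cond.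
by apply: leq_sum => b /andP[bH Pb]; rewrite mul1n le_m.
Qed.

(** The exceptional lines [a] lie on [f] and on a second surface not divisible by [f]: the curvature
    if possible, else the derivative in [Z]. The degree of either is at most [3 * D f], whence the
    bound [6 * D f ^ 2]. *)
Lemma surface_incidence_irreducible k f G H : degree_irreducible D f ->
  (forall n, (0 < n <= D f)%N -> n%:R != 0 :> K) ->
  uniq (map plane G) -> uniq (map plane H) -> lines_in (@restrict_red K) f G ->
  max_aligned k H ->
  exists a : pred line, (count a H <= 6 * D f ^ 2)%N /\
    (\sum_(b <- H | ~~ a b) count (inc^~ b) G <= 3 * D f * size H + k * size G)%N.
Proof.
move=> fI pchar uG uH Gf maxH; have [f0 df _] := fI.
have uF (P : pred line) : uniq (map plane (filter P H)).
  by apply: subseq_uniq uH; apply/map_subseq/filter_subseq.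
have leH (P : pred line) : (count P H <= size H)%N by rewrite count_size.
have [sf|sf] := leqP (size f) 1.
  (* If [Z] does not occur, [f] vanishes on the whole plane of each red line; these planes are roots
     of the leading coefficient in [v], so there are at most [D f] red lines. *)
  exists xpred0; split; first by rewrite count_pred0.
  have sG : (size G <= D f)%N.
    have fE := size1_polyC sf; have c0 : f`_0 != 0 by apply: contraNneq f0 => E; rewrite fE E.
    have x0 : lead_coef f`_0 != 0 by rewrite lead_coef_eq0.
    have := max_roots x0 uG; have -> : all (fun l => root (lead_coef f`_0) (plane l)) G.
      apply/allP => r rG; move/allP/(_ r rG): Gf; rewrite {1}fE /restrict_red eval_polyC.
      pose h := [the {rmorphism {poly K} -> K} of horner_eval (plane r)].
      have -> : eval_poly (eval_poly (@polyC K) (plane r)%:P) 'X f`_0 = map_poly h f`_0.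
        apply: eval_poly_coef_map => x.
        rewrite eval_polyE /= /horner_eval horner_coef rmorph_sum.
        by apply: eq_bigr => i _; rewrite rmorphM rmorphXn.
      move/eqP => /(congr1 (fun p : {poly K} => p`_(size f`_0).-1)).
      by rewrite coef_map coef0 /= -lead_coefE => /eqP.
    move=> /(_ isT)/leq_trans; apply.
    have := leq_poly_degree (@total_degree2 K) (_ : f`_0 != 0) => /(_ c0).
    rewrite addn0 => /(leq_trans _); apply.
    have := leq_poly_degree (poly_degree (fun _ : K => 0%N)) (_ : (f`_0)`_(size f`_0).-1 != 0).
    rewrite -lead_coefE => /(_ x0); rewrite poly_degree_const => /(leq_trans _); apply.
    exact: leq_addr.
  apply: leq_trans (count_incident_sum (m := D f) _) _ => [b _ _|].
    exact: leq_trans (count_size _ _) sG.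
  by have := leH xpredT; move: (count _ H) (size H) => *; nia.
have small b : restrict_blue b f != 0 -> (count (inc^~ b) G <= D f)%N.
  exact: count_incident uG Gf.
have [ruled|nruled] := pselect (divides f (curvature f)); last first.
  (* A line of [f] outside [a] meets at most [3 * D f] red lines, because the curvature vanishes on
     the red lines but not on it. *)
  pose a b := (restrict_blue b f == 0) && (restrict_blue b (curvature f) == 0).
  exists a; split.
    have := count_blue fI sf nruled (uF a); rewrite -size_filter => cnt.
    apply: leq_trans (cnt _ _) _.
    - by apply/allP => b; rewrite mem_filter => /andP[/andP[]].
    - by apply/allP => b; rewrite mem_filter => /andP[/andP[]].
    by have := total_degree_curvature f; move: (D f) (D _) => *; nia.
  apply: leq_trans (count_incident_sum (m := 3 * D f) _) _ => [b _|].
    rewrite negb_and => /orP[/small bf|bf]; first by apply: leq_trans bf _; lia.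
    apply: leq_trans (count_incident uG _ bf) (total_degree_curvature f).
    apply/allP => r /(allP Gf)/eqP rf; apply/eqP/curvature_eq0 => //.
      move=> x; rewrite eval_polyE raddf_sum big1 // => i _ /=.
      by rewrite -polyC_exp -polyCM derivC.
    by rewrite derivB derivZ derivX derivC subr0 alg_polyC derivC.
  by have := leH (fun b => ~~ a b); move: (count _ H) (size H) (D f) => *; nia.
(* The top exponent of [Z] lies between 1 and [D f], hence is nonzero in [K]. *)
have fZ0 : f^`() != 0.
  apply/eqP => /(congr1 (fun q : K3 => q`_(size f).-2)).
  rewrite coef_deriv coef0 prednK ?ltn_predRL // -lead_coefE -mulr_natr => /eqP.
  rewrite mulf_eq0 lead_coef_eq0 (negPf f0) orFb.
  rewrite -(rmorph_nat (@polyC {poly K})) polyC_eq0 -(rmorph_nat (@polyC K)) polyC_eq0.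
  apply/negP/pchar; have := size_poly_degree (@total_degree2 K) f; rewrite -/(D f).
  by move: (size f) (D f) sf => *; lia.
have ndvd : ~ divides f f^`().
  move=> [q qE]; have q0 : q != 0 by apply: contraNneq fZ0 => q0; rewrite qE q0 mul0r.
  have := lt_size_deriv f0; rewrite qE size_mul //.
  by move: q0; rewrite -size_poly_gt0; move: (size q) (size f) => *; lia.
pose a b := (restrict_blue b f == 0) && (restrict_blue b f^`() == 0).
exists a; split.
  have := count_blue fI sf ndvd (uF a); rewrite -size_filter => cnt.
  apply: leq_trans (cnt _ _) _.
  - by apply/allP => b; rewrite mem_filter => /andP[/andP[]].
  - by apply/allP => b; rewrite mem_filter => /andP[/andP[]].
  by have := total_degree_deriv f; move: (D f) (D _) => *; nia.
(* The smooth blue lines of the ruled case are aligned, so there are at most [k] of them, each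
   meeting at most all of [G]. *)
pose e b := (restrict_blue b f == 0) && (restrict_blue b f^`() != 0).
have se : (count e H <= k)%N.
  have [/eqP H0|] := boolP (filter e H == [::]).
    by rewrite -size_filter H0.
  case E : (filter e H) => [//|m H1] _; rewrite -size_filter.
  have me : m \in filter e H by rewrite E mem_head.
  move: me; rewrite mem_filter => /andP[/andP[/eqP mf mfZ] _].
  have [x [c [c0 rel]]] := ruled_blue_lines fI sf ruled pchar mf mfZ.
  apply: maxH.
  - exact: map_uniq (uF e).
  - by move=> b; rewrite mem_filter => /andP[].
  move=> b0 b1 b2; rewrite !mem_filter => /andP[/andP[/eqP z0 _] _].
  move=> /andP[/andP[/eqP z1 _] _] /andP[/andP[/eqP z2 _] _].
  apply: (blue_lines_aligned (m := m) c0 (a := x)) => b.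
  by rewrite !inE => /or3P[] /eqP ->; apply: rel.
rewrite (bigID e) /= addnC; apply: leq_add.
  apply: leq_trans (count_incident_sum (m := D f) _) _ => [b _|].
    by rewrite /a /e; case: eqP => //= [_ /andP[/negPf -> //]|/eqP bf _]; apply: small.
  by have := leH (fun b => ~~ a b && ~~ e b); move: (count _ H) (size H) (D f) => *; nia.
apply: leq_trans (count_incident_sum (m := size G) _) _ => [b _ _|]; first exact: count_size.
rewrite mulnC leq_mul2r; apply/orP; right; apply: leq_trans se; apply: sub_count => b.
by move=> /andP[].
Qed.
End Surface.

(** * Incidences between lines *)

Section Incidences.
Variable K : fieldType.
Local Notation K3 := {poly {poly {poly K}}}.
Local Notation D := (@total_degree K).
Local Notation line := (K * K * K)%type.
Local Notation inc := (@incident K).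
Implicit Types (f g : K3) (G H : seq line).

(** For a product, each red line lies on one of the factors. Splitting [G] accordingly makes the
    incidence bounds add up, and [6 d^2] is superadditive in the degree. *)
Lemma surface_incidence k f G H : f != 0 ->
  (forall n, (0 < n <= D f)%N -> n%:R != 0 :> K) ->
  uniq (map plane G) -> uniq (map plane H) -> lines_in (@restrict_red K) f G ->
  max_aligned k H ->
  exists a : pred line, (count a H <= 6 * D f ^ 2)%N /\
    (\sum_(b <- H | ~~ a b) count (inc^~ b) G <= 3 * D f * size H + k * size G)%N.
Proof.
have [n] := ubnP (D f); elim: n f G => // n IH f G ltn f0 pchar uG uH Gf maxH.
have [df|df] := posnP (D f).
  have fU := degree_unit (total_degreeP K) f0 df.
  case: G uG Gf => [_ _|r G _ /allP/(_ r (mem_head _ _))/eqP rf].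
    by exists xpred0; rewrite count_pred0 big1.
  by have := rmorph_unit (restrict_red r) fU; rewrite rf unitr0.
have [fI|nI] := pselect (degree_irreducible D f).
  exact: surface_incidence_irreducible.
have [f1 [f2 [fE d1 d2]]] : exists f1 f2, [/\ f = f1 * f2, (0 < D f1)%N & (0 < D f2)%N].
  apply: contrapT => H0; apply: nI; split=> // f1 f2 fE.
  have [d1|d1] := posnP (D f1); first by left.
  by have [d2|d2] := posnP (D f2); [right | case: H0; exists f1, f2].
have [f10 f20] : f1 != 0 /\ f2 != 0 by move: f0; rewrite fE mulf_eq0 negb_or => /andP[].
have dE : D f = (D f1 + D f2)%N by rewrite fE (degreeM (total_degreeP K)).
pose P r := restrict_red r f1 == 0.
have uF (Q : pred line) : uniq (map plane (filter Q G)).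
  by apply: subseq_uniq uG; apply/map_subseq/filter_subseq.
have [|||a1 [c1 s1]] := IH f1 (filter P G) _ f10 _ (uF _) uH _ maxH.
- by move: (D f) (D f1) (D f2) dE ltn d1 d2 => *; lia.
- by move=> j /andP[j0 jd]; apply: pchar; rewrite j0 (leq_trans jd) // dE leq_addr.
- by apply/allP => r; rewrite mem_filter => /andP[].
have [|||a2 [c2 s2]] := IH f2 (filter (predC P) G) _ f20 _ (uF _) uH _ maxH.
- by move: (D f) (D f1) (D f2) dE ltn d1 d2 => *; lia.
- by move=> j /andP[j0 jd]; apply: pchar; rewrite j0 (leq_trans jd) // dE leq_addl.
- apply/allP => r; rewrite mem_filter => /andP[/negPf nP] /(allP Gf).
  by rewrite fE rmorphM mulf_eq0 -/(P r) nP.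
exists (predU a1 a2); split.
  have := count_predUI a1 a2 H; move: dE c1 c2.
  by move: (count _ H) (count _ H) (count _ H) (count _ H) (D f) (D f1) (D f2) => *; nia.
have sG : (size G = size (filter P G) + size (filter (predC P) G))%N.
  by rewrite !size_filter count_predC.
apply: (@leq_trans (\sum_(b <- H | ~~ a1 b) count (inc^~ b) (filter P G) +
    \sum_(b <- H | ~~ a2 b) count (inc^~ b) (filter (predC P) G))%N).
  rewrite !(big_mkcond (fun b => ~~ _)) -big_split /=; apply: leq_sum => b _.
  rewrite negb_or; case: (a1 b) => //=; case: (a2 b) => //=.
  by rewrite -count_cat; apply/eq_leq/seq.permP; rewrite perm_sym perm_filterC.
move: s1 s2; rewrite sG dE; move: (\sum_(b <- _ | _) _)%N (\sum_(b <- _ | _) _)%N.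
by move: (size (filter P G)) (size (filter (predC P) G)) (size H) (D f1) (D f2) => *; nia.
Qed.

Lemma wide_kernel m n (M : 'M[K]_(m, n)) : (n < m)%N -> exists2 x : 'rV_m, x != 0 & x *m M = 0.
Proof.
move=> ltnm; have : kermx M != 0.
  by rewrite -mxrank_eq0 mxrank_ker -lt0n subn_gt0 (leq_ltn_trans (rank_leq_col M)).
by case/rowV0Pn => x /sub_kermxP xM x0; exists x.
Qed.

Definition monomial (i j k : nat) : K3 := (('X^i)%:P * 'X^j)%:P * 'X^k.

Lemma coef_monomial (c : K) i j k i' j' k' :
  (c%:P%:P%:P * monomial i j k)`_k'`_j'`_i' = c *+ [&& i == i', j == j' & k == k'].
Proof.
rewrite /monomial coefCM coefCM coefXn eq_sym; case: eqVneq => _;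
  last by rewrite mulr0 mulr0 !coef0 !andbF mulr0n.
rewrite mulr1 coefCM coefCM coefXn eq_sym; case: eqVneq => _;
  last by rewrite mulr0 mulr0 coef0 andbF mulr0n.
by rewrite mulr1 coefCM coefXn eq_sym; case: eqVneq; rewrite ?mulr1 ?mulr0.
Qed.

Lemma restrict_redC r (c : K) f : restrict_red r (c%:P%:P%:P * f) = c%:P * restrict_red r f.
Proof. by rewrite rmorphM; congr (_ * _); rewrite /restrict_red !eval_polyC. Qed.

Lemma poly_degreeXn_leq (R : idomainType) (dg : R -> nat) n :
  factorial_degree dg -> (poly_degree dg 'X^n <= n)%N.
Proof.
move=> dgP; apply: poly_degree_leP => i; rewrite coefXn.
by case: (eqVneq i n) => [-> _|_ /eqP//]; rewrite mulr1n (degree1 dgP).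
Qed.

Lemma total_degree_monomial (c : K) i j k :
  (D (c%:P%:P%:P * monomial i j k)%R <= i + j + k)%N.
Proof.
have P0 := field_degree_factorial K; have P1 := poly_degree_factorial P0.
have P2 := poly_degree_factorial P1; have P3 := poly_degree_factorial P2.
apply: leq_trans (degreeM_le P3 _ _) _.
rewrite (poly_degreeC P2) (poly_degreeC P1) (poly_degreeC P0) add0n.
apply: leq_trans (degreeM_le P3 _ _) _; apply: leq_add; last exact: poly_degreeXn_leq.
rewrite (poly_degreeC P2); apply: leq_trans (degreeM_le P2 _ _) _.
apply: leq_add; last exact: poly_degreeXn_leq.
by rewrite (poly_degreeC P1); apply: poly_degreeXn_leq.
Qed.

(** Dimension count: there are [n.+1 ^ 3] monomials with all exponents at most [n], and vanishing on
    a red line imposes [3 n + 1] linear conditions. *)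
Lemma exists_surface n G : (size G * (3 * n).+1 < n.+1 ^ 3)%N ->
  exists f, [/\ f != 0, (D f <= 3 * n)%N & lines_in (@restrict_red K) f G].
Proof.
move=> lt_dim; pose I := 'I_n.+1; pose c0 : line := (0, 0, 0).
pose T := (I * I * I)%type; pose C := ('I_(size G) * 'I_(3 * n).+1)%type.
pose mono (t : T) := monomial t.1.1 t.1.2 t.2.
pose M := \matrix_(t < #|{: T}|, s < #|{: C}|)
  (restrict_red (nth c0 G (enum_val s).1) (mono (enum_val t)))`_(enum_val s).2.
have [|x x0 xM] := wide_kernel M.
  by rewrite !card_prod !card_ord; move: lt_dim; rewrite !expnS expn0 muln1 mulnA.
pose f : K3 := \sum_(t : T) (x 0 (enum_rank t))%:P%:P%:P * mono t.
have coeff (t : T) : f`_(t.2)`_(t.1.2)`_(t.1.1) = x 0 (enum_rank t).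
  rewrite /f !coef_sum (bigD1 t) //= coef_monomial !eqxx mulr1n big1 ?addr0 //.
  case: t => [[i' j'] k'] [[i j] k] /=; rewrite !xpair_eqE -!val_eqE /= -andbA => /negPf ne.
  by rewrite coef_monomial ne mulr0n.
have Df : (D f <= 3 * n)%N.
  apply: (degree_sum (total_degreeP K)) => [[[i j] k]] _ _.
  apply: leq_trans (total_degree_monomial _ _ _ _) _.
  by have := ltn_ord i; have := ltn_ord j; have := ltn_ord k; rewrite /=; lia.
exists f; split => //.
  have [t xt] : exists t, x 0 (enum_rank t) != 0.
    have /rV0Pn[s xs] := x0.
    by exists (enum_val s); rewrite enum_valK.
  by apply: contraNneq xt => f0; rewrite -coeff f0 !coef0.
apply/allP => r rG; apply/eqP/polyP => s; rewrite coef0.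
have [lts|les] := ltnP s (3 * n).+1; last first.
  by rewrite nth_default // (leq_trans (size_restrict_red r f)) // (leq_trans _ les).
have ltr : (index r G < size G)%N by rewrite index_mem.
have := congr1 (fun y : 'rV_ _ => y 0 (enum_rank (Ordinal ltr, Ordinal lts))) xM.
rewrite !mxE => E; rewrite -[RHS]E /f rmorph_sum coef_sum.
rewrite (reindex_onto (@enum_val T xpredT) enum_rank); last by move=> t _; rewrite enum_rankK.
apply: eq_big => [t|t _]; first by rewrite enum_valK eqxx.
rewrite enum_valK mxE enum_rankK nth_index //.
by rewrite restrict_redC coefCM.
Qed.
End Incidences.

(** * Iteration over scales *)

Section Levels.
Variable K : fieldType.
Local Notation D := (@total_degree K).
Local Notation line := (K * K * K)%type.
Local Notation inc := (@incident K).
Implicit Types (G H : seq line).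

Definition incidences G H : nat := \sum_(b <- H) count (inc^~ b) G.

Lemma incidences_chunks G H m X Y g :
  (forall G', uniq (map plane G') -> (size G' <= m)%N -> (incidences G' H <= X + Y * size G')%N) ->
  uniq (map plane G) -> (size G <= g * m)%N -> (incidences G H <= g * X + Y * size G)%N.
Proof.
move=> chunk; elim: g G => [|g IH] G uG sG.
  have -> : G = [::] by apply: size0nil; lia.
  by rewrite /incidences big1.
have cat_inc : incidences G H = (incidences (take m G) H + incidences (drop m G) H)%N.
  by rewrite /incidences -big_split /=; apply: eq_bigr => b _; rewrite -count_cat cat_take_drop.
have [ut ud] : uniq (map plane (take m G)) /\ uniq (map plane (drop m G)).
  by rewrite map_take map_drop take_uniq // drop_uniq.
rewrite mulSn in sG; have sd : (size (drop m G) <= g * m)%N by rewrite size_drop; lia.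
have st : (size (take m G) <= m)%N by rewrite size_take_min geq_minl.
have sE : size G = (size (take m G) + size (drop m G))%N by rewrite -size_cat cat_take_drop.
have := IH _ ud sd; have := chunk _ ut st; rewrite cat_inc sE.
by move: (incidences _ _) (incidences _ _) (size (take _ _)) (size (drop _ _)) => *; nia.
Qed.

Lemma incidences_trivial G H : (incidences G H <= size G * size H)%N.
Proof.
rewrite /incidences mulnC -[size H]count_predT -sum1_count big_distrl /=.
by apply: leq_sum => b _; rewrite mul1n count_size.
Qed.

(* [H'] consists of the exceptional blue lines of a surface of degree [O(n)] through [G]. *)
Lemma incidences_chunk k n m G H : uniq (map plane G) -> uniq (map plane H) ->
  (forall j, (0 < j <= 3 * n)%N -> j%:R != 0 :> K) -> max_aligned k H ->
  (m * (3 * n).+1 < n.+1 ^ 3)%N -> (size G <= m)%N ->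
  exists H', [/\ uniq (map plane H'), {subset H' <= H}, (size H' <= 54 * n ^ 2)%N &
    (incidences G H <= 9 * n * size H + k * size G + incidences G H')%N].
Proof.
move=> uG uH pchar maxH ltm sG.
have [|f [f0 Df Gf]] := @exists_surface K n G.
  by apply: leq_ltn_trans ltm; rewrite leq_mul2r sG orbT.
have [|a [ca sa]] := surface_incidence f0 _ uG uH Gf maxH.
  by move=> j /andP[j0 jd]; apply: pchar; rewrite j0 (leq_trans jd).
exists (filter a H); split.
- by apply: subseq_uniq uH; apply/map_subseq/filter_subseq.
- by move=> b; rewrite mem_filter => /andP[].
(* With degree at most [3 n] the exceptional lines number at most [6 (3 n)^2]. *)
- rewrite size_filter; move: (D f) (count a H) Df ca => *; nia.
rewrite /incidences (bigID a) /= addnC leq_add //; last by rewrite big_filter.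
by apply: leq_trans sa _; move: (D f) (size H) Df => *; nia.
Qed.

(** Induction on the scale: surfaces through chunks of [G] leave exceptional blue lines, few enough
    for the previous level. Each level charges [k] to every red line, whence the factor [l.+1]. *)
Theorem lines_incidence h q k l G H : (32 <= h)%N -> q = (16 * h)%N ->
  uniq (map plane G) -> uniq (map plane H) ->
  (forall j, (0 < j <= q ^ l)%N -> j%:R != 0 :> K) -> max_aligned k H ->
  (size G <= (q ^ l.+1) ^ 2)%N -> (size H <= (q ^ l.+1) ^ 2)%N ->
  (incidences G H <= 576 * q * (q ^ l.+1) ^ 3 + l.+1 * (k * size G))%N.
Proof.
move=> h32 qh; elim: l G H => [|l IH] G H uG uH pchar maxH sG sH.
  apply: leq_trans (incidences_trivial G H) _; rewrite expn1 in sG sH *.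
  have q0 : (0 < q)%N by rewrite qh; lia.
  have := leq_mul sG sH; rewrite -expnD => /leq_trans; apply; apply: leq_trans (leq_addr _ _).
  by rewrite (_ : 2 + 2 = 4)%N // (expnS q 3) leq_mul2r; apply/orP; right; lia.
pose t := (q ^ l)%N; have qE : (q ^ l.+1 = q * t)%N by rewrite expnS.
have qE2 : (q ^ l.+2 = q * (q * t))%N by rewrite !expnS.
have t0 : (0 < t)%N by rewrite expn_gt0 qh; lia.
have tE : (q ^ l = t)%N by [].
clearbody t; rewrite qE2 in sG sH *.
(* As [x^2 (6x + 1) < (2x + 1)^3], a surface of degree at most [3 n = 6 x] contains [m] given red
   lines. Moreover [6 x <= 16 x = q * t] respects the characteristic, and the at most
   [54 n^2 = 216 x^2] exceptional lines fit below [(16 x)^2]. *)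
pose x := (h * t)%N; pose n := (2 * x)%N; pose m := (x ^ 2)%N.
have qt : (q * t = 16 * x)%N by rewrite qh mulnA.
have chunk G' : uniq (map plane G') -> (size G' <= m)%N ->
   (incidences G' H <= (9 * n * size H + 576 * q * (q * t) ^ 3) + (k + l.+1 * k) * size G')%N.
  move=> uG' sG'.
  have [||H' [uH' subH sH' incH']] := @incidences_chunk k n m G' H uG' uH _ maxH _ sG'.
  - by move=> j /andP[j0 jn]; apply: pchar; rewrite j0 (leq_trans jn) // qE qt /n; lia.
  - by rewrite /m /n; clearbody x; rewrite !expnS expn0 !muln1; nia.
  have := IH G' H' uG' uH' _ (max_aligned_sub subH maxH); rewrite qE => IH'.
  have {}IH' : (incidences G' H' <= 576 * q * (q * t) ^ 3 + l.+1 * (k * size G'))%N.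
    apply: IH'.
    - move=> j /andP[j0 jn]; apply: pchar; rewrite j0 (leq_trans jn) // tE qE.
      by rewrite leq_pmull // qh; lia.
    - by apply: leq_trans sG' _; rewrite /m qt leq_exp2r //; lia.
    by apply: leq_trans sH' _; rewrite /n qt !expnMn; lia.
  by apply: leq_trans incH' _; rewrite (mulnDl k) -(mulnA l.+1) addnACA leq_add2l.
(* Since [q * (q * t) = 16 q x], this number of chunks covers [G]. *)
have := @incidences_chunks G H m _ _ (256 * q ^ 2)%N chunk uG.
have -> : (size G <= 256 * q ^ 2 * m)%N.
  apply: leq_trans sG _; rewrite -!mulnn /m qt -!mulnn; clearbody x.
  by rewrite (mulnC q (16 * x)) mulnACA; nia.
move=> /(_ isT)/leq_trans; apply.
have -> : (l.+2 * (k * size G) = (k + l.+1 * k) * size G)%N by rewrite !mulnA mulSn mulnDl.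
rewrite leq_add2r; move: (size H) sH => s sH; have q512 : (512 <= q)%N by rewrite qh; lia.
have yE : (q * t = 8 * n)%N by rewrite qt /n; lia.
move: (q * t)%N yE sH => y yE sH; move: n yE {chunk} => z yE.
(* One half pays for the ordinary lines of all chunks, the other for the recursion, where
   [256 * 576 = 288 * 512] and [q >= 512]. *)
have -> : (576 * q * (q * y) ^ 3 = 288 * q ^ 4 * y ^ 3 + 288 * q ^ 4 * y ^ 3)%N by ring.
rewrite mulnDr; apply: leq_add.
  have -> : (256 * q ^ 2 * (9 * z * s) = 288 * q ^ 2 * (8 * z) * s)%N by ring.
  have -> : (288 * q ^ 4 * y ^ 3 = 288 * q ^ 2 * y * (q * y) ^ 2)%N by ring.
  by rewrite -yE leq_mul2l sH orbT.
have -> : (256 * q ^ 2 * (576 * q * y ^ 3) = 288 * q ^ 3 * y ^ 3 * 512)%N by ring.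
have -> : (288 * q ^ 4 * y ^ 3 = 288 * q ^ 3 * y ^ 3 * q)%N by ring.
by rewrite leq_mul2l q512 orbT.
Qed.
End Levels.

(** * From points and planes to lines *)

Section Lift.
Variable F : fieldType.
Local Notation triple := (F * F * F)%type.
Implicit Types x y z : triple.

Definition collinear x y z : Prop :=
  [/\ (y.1.1 - x.1.1) * (z.1.2 - x.1.2) = (z.1.1 - x.1.1) * (y.1.2 - x.1.2),
      (y.1.1 - x.1.1) * (z.2 - x.2) = (z.1.1 - x.1.1) * (y.2 - x.2) &
      (y.1.2 - x.1.2) * (z.2 - x.2) = (z.1.2 - x.1.2) * (y.2 - x.2)].

(* [y] stands for the plane of the points [(X, Y, Z)] with [X + Y * y.2 = y.1.1 + y.1.2 * Z]. *)
Definition on_plane x y : bool := x.1.1 + x.1.2 * y.2 == y.1.1 + y.1.2 * x.2.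

(** The conclusion is the vanishing of the determinant with rows [(k, s, p)]: collinearity in
    homogeneous coordinates. *)
Lemma ratio_det (K : fieldType) (k0 k1 k2 s0 s1 s2 p0 p1 p2 : K) :
  k0 != 0 -> k1 != 0 -> k2 != 0 ->
  (s1 / k1 - s0 / k0) * (p2 / k2 - p0 / k0) = (s2 / k2 - s0 / k0) * (p1 / k1 - p0 / k0) ->
  k0 * (s1 * p2 - s2 * p1) - s0 * (k1 * p2 - k2 * p1) + p0 * (k1 * s2 - k2 * s1) = 0.
Proof.
move=> k00 k10 k20 /eqP; rewrite -subr_eq0 => /eqP E.
transitivity (k0 * k1 * k2 * 0); last by rewrite mulr0.
by rewrite -E; field; rewrite k00 k10 k20.
Qed.

Section Transcendental.
Variables (K : fieldType) (iota : {rmorphism F -> K}) (t : K).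
Hypothesis t_free : forall a b c d : F,
  iota a + iota b * t + iota c * t ^+ 2 + iota d * t ^+ 3 = 0 -> [/\ a = 0, b = 0, c = 0 & d = 0].

Definition weight x := 1 + t ^+ 2 * iota x.1.1.

(** Points and planes share one formula. In the incidence relation, multiplied by both weights, the
    terms with [t] and [t ^+ 2] are symmetric and cancel; their purpose is to separate the values of
    [plane]. *)
Definition lift x : K * K * K :=
  (iota x.2 / weight x, iota x.1.1 / weight x, (iota x.1.2 + t * iota x.2) / weight x).

Lemma weight_neq0 x : weight x != 0.
Proof.
apply/eqP => w0; have [|/eqP] := @t_free 1 0 x.1.1 0; last by rewrite oner_eq0.
by rewrite rmorph1 rmorph0 !mul0r !addr0 mulrC.
Qed.

Lemma lift_incident x y : incident (lift x) (lift y) = on_plane x y.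
Proof.
have := weight_neq0 x; have := weight_neq0 y; rewrite /incident /on_plane /slope /plane /shift /=.
rewrite /weight; case: x => [[x1 x2] x3]; case: y => [[y1 y2] y3] /= wy wx.
rewrite -(inj_eq (fmorph_inj iota)) !rmorphD !rmorphM.
move: (iota x1) (iota x2) (iota x3) (iota y1) (iota y2) (iota y3) wx wy.
move=> {}x1 {}x2 {}x3 {}y1 {}y2 {}y3 wx wy.
rewrite -subr_eq0 -[in RHS]subr_eq0.
have -> : x3 / (1 + t ^+ 2 * x1) * ((y2 + t * y3) / (1 + t ^+ 2 * y1)) - x1 / (1 + t ^+ 2 * x1) -
   (y3 / (1 + t ^+ 2 * y1) * ((x2 + t * x3) / (1 + t ^+ 2 * x1)) - y1 / (1 + t ^+ 2 * y1))
  = - (x1 + x2 * y3 - (y1 + y2 * x3)) / ((1 + t ^+ 2 * x1) * (1 + t ^+ 2 * y1)).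
  by field; rewrite wx wy.
by rewrite mulf_eq0 invr_eq0 mulf_eq0 (negPf wx) (negPf wy) !orbF oppr_eq0.
Qed.

(** Cross-multiplying gives a cubic in [t]. Its first two coefficients identify the last two
    coordinates, and the one of [t ^+ 2] the first, as [x.1.2] is nonzero. *)
Lemma lift_plane_inj x y : x.1.2 != 0 -> plane (lift x) = plane (lift y) -> x = y.
Proof.
rewrite /plane /= => x2 /eqP; rewrite eqr_div ?weight_neq0 // -subr_eq0 /weight => /eqP E.
have [|/eqP e2 /eqP e3 /eqP e1 _] := @t_free (x.1.2 - y.1.2) (x.2 - y.2)
  (x.1.2 * y.1.1 - y.1.2 * x.1.1) (x.2 * y.1.1 - y.2 * x.1.1).
  by rewrite !rmorphB !rmorphM -[RHS]E; ring.
rewrite subr_eq0 in e2; rewrite subr_eq0 in e3; move: e1; rewrite -(eqP e2) -mulrBr mulf_eq0 (negPf x2).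
rewrite subr_eq0 => /eqP e1; case: x y e1 e2 e3 {x2 E} => [[a b] c] [[a' b'] c'] /=.
by move=> -> /eqP -> /eqP ->.
Qed.

(** The two alignment determinants are polynomials in [t] over [F]. The one with [shift] has two of
    the collinearity minors as coefficients, the one with [slope] has the third as constant term. *)
Lemma lift_aligned x y z : aligned (lift x) (lift y) (lift z) -> collinear x y z.
Proof.
have := weight_neq0 x; have := weight_neq0 y; have := weight_neq0 z.
rewrite /aligned /collinear /slope /plane /shift /= /weight.
case: x => [[x1 x2] x3]; case: y => [[y1 y2] y3]; case: z => [[z1 z2] z3] /= wz wy wx [e1 e2].
have [|] := @t_free ((y1 - x1) * (z2 - x2) - (z1 - x1) * (y2 - x2))
    ((y1 - x1) * (z3 - x3) - (z1 - x1) * (y3 - x3)) 0 0.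
  have := ratio_det wx wy wz e2.
  by rewrite !(rmorphB, rmorphM) rmorph0 !mul0r !addr0 => E; rewrite -[RHS]E; ring.
move=> /eqP + /eqP + _ _; rewrite !subr_eq0 => /eqP E1 /eqP E2.
have [|] := @t_free ((y2 - x2) * (z3 - x3) - (z2 - x2) * (y3 - x3)) 0
    (x1 * (y2 * z3 - z2 * y3) - y1 * (x2 * z3 - z2 * x3) + z1 * (x2 * y3 - y2 * x3)) 0.
  have := ratio_det wx wy wz e1; rewrite !(rmorphD, rmorphB, rmorphM) rmorph0 !mul0r !addr0 => E.
  by apply: oppr_inj; rewrite oppr0 -[RHS]E; ring.
by move=> /eqP; rewrite subr_eq0 => /eqP.
Qed.

Lemma point_plane_level h q l k (P Q : seq triple) : (32 <= h)%N -> q = (16 * h)%N ->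
  uniq P -> uniq Q -> {in P, forall x, x.1.2 != 0} -> {in Q, forall x, x.1.2 != 0} ->
  (forall j, (0 < j <= q ^ l)%N -> j%:R != 0 :> F) ->
  (forall S, uniq S -> {subset S <= Q} -> {in S & &, forall x y z, collinear x y z} ->
    (size S <= k)%N) ->
  (size P <= (q ^ l.+1) ^ 2)%N -> (size Q <= (q ^ l.+1) ^ 2)%N ->
  (\sum_(y <- Q) count (on_plane^~ y) P <= 576 * q * (q ^ l.+1) ^ 3 + l.+1 * (k * size P))%N.
Proof.
move=> h32 qh uP uQ P0 Q0 pchar colQ sP sQ.
have u_lift S : uniq S -> {in S, forall x, x.1.2 != 0} -> uniq (map plane (map lift S)).
  move=> uS S0; rewrite -map_comp map_inj_in_uniq // => x y xS _.
  exact/lift_plane_inj/S0.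
have -> : (\sum_(y <- Q) count (on_plane^~ y) P)%N = incidences (map lift P) (map lift Q).
  rewrite /incidences big_map; apply: eq_bigr => y _; rewrite count_map.
  by apply: eq_count => x; rewrite /= lift_incident.
rewrite -(size_map lift P); apply: (lines_incidence h32 qh); rewrite ?size_map ?u_lift //.
  by move=> j /pchar; rewrite -(rmorph_nat iota) fmorph_eq0.
move=> S uS sS colS; pose S' := filter (fun y => lift y \in S) Q.
apply: (@leq_trans (size S')).
  rewrite -(size_map lift); apply: uniq_leq_size => // b bS.
  have /mapP[y yQ bE] := sS b bS; apply/mapP; exists y => //.
  by rewrite mem_filter -bE bS.
apply: colQ; first exact: filter_uniq.
  by move=> y; rewrite mem_filter => /andP[].
move=> x y z; rewrite !mem_filter => /andP[xS _] /andP[yS _] /andP[zS _].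
exact/lift_aligned/colS.
Qed.
End Transcendental.

Lemma fraction_polyX_free (a b c d : F) 
    (iota : {rmorphism F -> {fraction {poly F}}} := @FracField.tofrac {poly F} \o @polyC F)
    (t := FracField.tofrac ('X : {poly F})) :
  iota a + iota b * t + iota c * t ^+ 2 + iota d * t ^+ 3 = 0 -> [/\ a = 0, b = 0, c = 0 & d = 0].
Proof.
rewrite /iota /t /= -!(rmorphXn, rmorphM, rmorphD) => /eqP; rewrite tofrac_eq0 => /eqP E.
have coef i := congr1 (fun f : {poly F} => f`_i) E.
by split; [move: (coef 0) | move: (coef 1) | move: (coef 2) | move: (coef 3)];
  rewrite !coefD coefC coefMX !coefCM !coefXn coefC /= coef0 ?(mulr0, mulr1, addr0, add0r).
Qed.
End Lift.

Lemma level_exists q N : (1 < q)%N -> exists l,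
  (N <= (q ^ l.+1) ^ 2)%N /\ (l = 0%N \/ ((q ^ l) ^ 2 < N)%N).
Proof.
move=> q1; have exl : exists l, (N <= (q ^ l.+1) ^ 2)%N.
  exists N; apply: leq_trans (ltnW (ltn_expl N q1)) _.
  by rewrite -expnM leq_exp2l //; lia.
have [[|l] leN minl] := ex_minnP exl; first by exists 0%N; split=> //; left.
exists l.+1; split=> //; right; rewrite ltnNge; apply/negP => /minl; lia.
Qed.

(** The least level [l] reaching [N] is used. Requiring [k ^ 8 <= N ^ 3], more than [k ^ 2 <= N],
    leaves a factor [N^(1/8)] to absorb the number of levels. *)
Theorem point_plane_incidences : exists C, forall (F : fieldType) p (P Q : seq (F * F * F)) N k,
  p \in [pchar F] -> uniq P -> uniq Q ->
  {in P, forall x, x.1.2 != 0} -> {in Q, forall x, x.1.2 != 0} ->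
  (size P <= N)%N -> (size Q <= N)%N ->
  (forall S, uniq S -> {subset S <= Q} -> {in S & &, forall x y z, collinear x y z} ->
    (size S <= k)%N) ->
  (k ^ 8 <= N ^ 3)%N -> (N <= p ^ 2)%N ->
  ((\sum_(y <- Q) count ((@on_plane F)^~ y) P) ^ 2 <= C * N ^ 3)%N.
Proof.
have [h [q [h32 qh q1]]] : exists h q, [/\ (32 <= h)%N, q = (16 * h)%N & (256 <= q)%N].
  by exists 32%N, (16 * 32)%N; split.
exists (2 * (576 * q ^ 4) ^ 2 + 2)%N => F p P Q N k pF uP uQ P0 Q0 sP sQ colQ leNk leNp.
have p_pr := pcharf_prime pF.
have [N0|N0] := posnP N.
  have -> : Q = [::] by apply: size0nil; lia.
  by rewrite big_nil.
have [l [leN lN]] := level_exists N (ltac:(lia) : (1 < q)%N).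
have qlN : ((q ^ l) ^ 2 <= N)%N by case: lN => [->|/ltnW].
(* By minimality of [l] and [N <= p ^ 2], every integer up to [q ^ l] lies below the
   characteristic. *)
have qlp : (q ^ l < p)%N.
  case: lN => [->|ltN]; first by rewrite expn0 prime_gt1.
  by rewrite -(ltn_exp2r _ _ (isT : 0 < 2)%N) (leq_trans ltN).
have pchar j : (0 < j <= q ^ l)%N -> j%:R != 0 :> F.
  move=> /andP[j0 jl]; rewrite -(dvdn_pcharf pF) gtnNdvd //; exact: leq_ltn_trans jl qlp.
have := point_plane_level (@fraction_polyX_free F) h32 qh uP uQ P0 Q0 pchar colQ
  (leq_trans sP leN) (leq_trans sQ leN).
move: (\sum_(y <- Q) _)%N => I leI.
(* Here [(l + 1)^8 <= 256^l <= q^l], so [(l + 1)^8 k^8 <= N * N^3]. *)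
have kl : ((l.+1 * k) ^ 2 <= N)%N.
  rewrite -(@leq_exp2r _ _ 4) // -expnM expnMn.
  have l8 : (l.+1 ^ 8 <= (q ^ l) ^ 2)%N.
    have l2 : (l.+1 <= 2 ^ l)%N by exact: ltn_expl.
    apply: (@leq_trans ((2 ^ l) ^ 8)); first by rewrite leq_exp2r.
    have -> : ((2 ^ l) ^ 8 = 256 ^ l)%N by rewrite -expnM mulnC expnM.
    apply: (@leq_trans (q ^ l)); last by rewrite -mulnn leq_pmull // expn_gt0; lia.
    by case: (l) => [|l'] //; rewrite leq_exp2r.
  by rewrite [X in (_ <= X)%N]expnS; apply: leq_mul => //; apply: leq_trans qlN.
have A2 : ((576 * q * (q ^ l.+1) ^ 3) ^ 2 <= (576 * q ^ 4) ^ 2 * N ^ 3)%N.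
  have -> : (576 * q * (q ^ l.+1) ^ 3 = 576 * q ^ 4 * (q ^ l) ^ 3)%N.
    by rewrite (expnS q l); move: (q ^ l)%N => x; ring.
  by rewrite expnMn leq_mul2l expnAC leq_exp2r // qlN orbT.
have B2 : ((l.+1 * (k * size P)) ^ 2 <= N ^ 3)%N.
  rewrite mulnA expnMn (expnS N); apply: leq_mul => //.
  by rewrite leq_exp2r.
apply: (@leq_trans ((576 * q * (q ^ l.+1) ^ 3 + l.+1 * (k * size P)) ^ 2)).
  by rewrite leq_exp2r.
move: A2 B2; move: (576 * q * _)%N (l.+1 * _)%N ((576 * q ^ 4) ^ 2)%N (N ^ 3)%N => a b c d ad bd.
have ab : (2 * (a * b) <= a ^ 2 + b ^ 2)%N by rewrite nat_Cauchy.
rewrite sqrnD mulnDl -mulnA; move: (a ^ 2)%N (b ^ 2)%N (a * b)%N (c * d)%N ad bd ab => *; lia.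
Qed.

Lemma cauchy_schwarz (T : finType) (f : T -> nat) :
  ((\sum_s f s) ^ 2 <= #|T| * \sum_s f s ^ 2)%N.
Proof.
rewrite -(leq_pmul2l (isT : 0 < 2)%N) -mulnn big_distrl /= big_distrr /=.
apply: (@leq_trans (\sum_s \sum_s' (f s ^ 2 + f s' ^ 2))%N).
  by apply: leq_sum => s _; rewrite !big_distrr; apply: leq_sum => s' _; exact: nat_Cauchy.
under eq_bigr do rewrite big_split /= sum_nat_const.
by rewrite big_split /= sum_nat_const -big_distrr /= mul2n addnn.
Qed.

(** * Energy *)

Section Energy.
Variable F : fieldType.
Local Notation triple := (F * F * F)%type.
Implicit Types (x y z : triple) (Z : seq (F * F)) (W : seq F) (S : seq triple) (V : {fset F}).

(** If two distinct points of a line agree in a coordinate, collinearity forces every third point to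
    agree as well. *)
Lemma collinear_const (pi : triple -> F) S :
  (pi =1 (fun x => x.1.1) \/ pi =1 (fun x => x.1.2) \/ pi =1 (fun x => x.2)) ->
  {in S & &, forall x y z, collinear x y z} ->
  {in S &, injective pi} \/ {in S &, forall x y, pi x = pi y}.
Proof.
move=> piP colS; have [inj|ninj] := pselect ({in S &, injective pi}); [by left | right].
have [x [y [xS yS pixy nxy]]] : exists x y, [/\ x \in S, y \in S, pi x = pi y & x <> y].
  apply: contrapT => H; apply: ninj => x y xS yS pixy; apply: contrapT => nxy.
  by apply: H; exists x, y.
have pix z : z \in S -> pi z = pi x.
  move=> zS; have [e1 e2 e3] := colS x y z xS yS zS.
  have prod0 (a b : F) : a * b = 0 -> a = 0 \/ b = 0.
    by move=> /eqP; rewrite mulf_eq0 => /orP[] /eqP; [left | right].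
  have sub0 (a b : F) : a - b = 0 -> a = b by move=> /eqP; rewrite subr_eq0 => /eqP.
  apply: contrapT => nz; apply: nxy.
  case: x y z {xS yS zS} pixy nz e1 e2 e3 => [[x1 x2] x3] [[y1 y2] y3] [[z1 z2] z3].
  case: piP => [piE|[piE|piE]]; rewrite !piE /= => <- nz; rewrite subrr ?mul0r ?mulr0.
  - move=> /esym/prod0[/sub0//|/sub0 ->] /esym/prod0[/sub0//|/sub0 ->] //.
  - move=> /prod0[/sub0 ->|/sub0//] _ /esym/prod0[/sub0//|/sub0 ->] //.
  - move=> _ /prod0[/sub0 ->|/sub0//] /prod0[/sub0 ->|/sub0//] //.
by move=> a b /pix -> /pix ->.
Qed.

Definition triples Z W : seq triple := [seq (s, c) | s <- Z, c <- W].
Definition value x : F := x.1.1 + x.1.2 * x.2.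

Lemma triplesP Z W x : reflect (x.1 \in Z /\ x.2 \in W) (x \in triples Z W).
Proof.
apply: (iffP allpairsP) => [[[s c] /= [sZ cW ->]] //|[sZ cW]].
by exists (x.1, x.2); case: x sZ cW.
Qed.

Lemma triples_uniq Z W : uniq Z -> uniq W -> uniq (triples Z W).
Proof.
move=> uZ uW; apply: allpairs_uniq => //.
by move=> [s c] [s' c'] _ _ /= [-> ->].
Qed.

(** A line on which the third coordinate varies is counted by [W]; one on which only the first two
    vary, by the second coordinates; otherwise it lies in a fibre over a fixed second coordinate. *)
Lemma collinear_triples_size Z W S k :
  uniq S -> {subset S <= triples Z W} -> {in S & &, forall x y z, collinear x y z} ->
  (size W <= k)%N -> (size (undup (map snd Z)) <= k)%N ->
  (forall b, count (fun s : F * F => s.2 == b) Z <= k)%N -> (size S <= k)%N.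
Proof.
move=> uS sS colS sW sZ cZ.
have inj_size (pi : triple -> F) (B : seq F) : {in S &, injective pi} ->
    {in S, forall x, pi x \in B} -> (size S <= size B)%N.
  move=> inj piB; rewrite -(size_map pi); apply: uniq_leq_size; first by rewrite map_inj_in_uniq.
  by move=> _ /mapP[x /piB + ->].
have [inj3|const3] := collinear_const (pi := fun x => x.2) (or_intror (or_intror (fun=> erefl))) colS.
  by apply: leq_trans sW; apply: inj_size inj3 _ => x /sS/triplesP[].
have [inj2|const2] := collinear_const (pi := fun x => x.1.2) (or_intror (or_introl (fun=> erefl))) colS.
  apply: leq_trans sZ; apply: inj_size inj2 _ => x /sS/triplesP[xZ _].
  by rewrite mem_undup; apply/mapP; exists x.1.
case: S uS sS {colS inj_size} const3 const2 => [//|x S] uS sS const3 const2.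
apply: leq_trans (cZ x.1.2); rewrite -size_filter -(size_map fst); apply: uniq_leq_size.
  rewrite map_inj_in_uniq // => y z yS zS; have := const3 y z yS zS.
  by case: y z {yS zS} => [a b] [c d] /= -> ->.
move=> _ /mapP[y yS ->]; rewrite mem_filter; apply/andP; split.
  by rewrite (const2 y x) // mem_head.
by have [] := triplesP _ _ _ (sS y yS).
Qed.

(** Exchanging the third coordinates of [x] and [y], which both range over [W], turns equality of
    values into the incidence [on_plane]. *)
Lemma energy_swap Z W :
  (\sum_(y <- triples Z W) count (fun x => value x == value y) (triples Z W) =
   \sum_(y <- triples Z W) count ((@on_plane F)^~ y) (triples Z W))%N.
Proof.
under eq_bigr do rewrite -sum1_count big_mkcond /triples big_allpairs_dep /=.
under [RHS]eq_bigr do rewrite -sum1_count big_mkcond /triples big_allpairs_dep /=.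
rewrite /triples !big_allpairs_dep /=; apply: eq_bigr => z' _.
rewrite exchange_big [RHS]exchange_big; apply: eq_bigr => z _.
by rewrite exchange_big; apply: eq_bigr => c _; apply: eq_bigr => c' _.
Qed.

(** Cauchy-Schwarz for the number [f s] of representations of each [s] in [V]. *)
Lemma energy_lower_bound (L : seq triple) V :
  ((count (fun x => value x \in V) L) ^ 2 <=
   #|` V| * \sum_(y <- L) count (fun x => value x == value y) L)%N.
Proof.
pose f (s : V) := count (fun x => value x == val s) L.
(* Grouping the triples by value. The default 0 is never reached, as the sum runs over values in
   [V]. *)
have cf (g : V -> nat) : (\sum_(y <- L | value y \in V) oapp g 0 (insub (value y)) = \sum_s f s * g s)%N.
  rewrite /f; under [RHS]eq_bigr do rewrite -sum1_count big_distrl /=.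
  rewrite (exchange_big_dep (fun y => value y \in V)) /=; last first.
    by move=> s y _ /eqP ->; exact: valP.
  apply: eq_bigr => y yV; rewrite (insubT (mem V) yV) /=.
  rewrite (big_pred1 (Sub (value y) yV)) ?mul1n //.
have -> : count (fun x => value x \in V) L = (\sum_s f s)%N.
  rewrite -sum1_count -[RHS](eq_bigr _ (fun s _ => muln1 (f s))) -cf; apply: eq_bigr => y yV.
  by rewrite (insubT (mem V) yV).
rewrite cardfE; apply: leq_trans (cauchy_schwarz f) _; rewrite leq_mul2l; apply/orP; right.
under eq_bigr do rewrite -mulnn; rewrite -cf big_mkcond /=.
apply: leq_sum => y _; case: ifP => // yV; by rewrite (insubT (mem V) yV).
Qed.
End Energy.

(** With [N] triples, [m] of them with value in [V], the conclusion reads [m^4 <= C |V|^2 N^3]. The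
    three bounds by [k] control collinear triples; [C] is uniform in the field. *)
Definition energy_constant C : Prop :=
  forall (F : fieldType) p (Z : seq (F * F)) (W : seq F) (V : {fset F}) k,
  p \in [pchar F] -> uniq Z -> uniq W -> {in Z, forall z, z.2 != 0} ->
  (size W <= k)%N -> (size (undup (map snd Z)) <= k)%N ->
  (forall b, count (fun z => z.2 == b) Z <= k)%N ->
  (k ^ 8 <= (size Z * size W) ^ 3)%N -> (size Z * size W <= p ^ 2)%N ->
  ((count (fun x => value x \in V) (triples Z W)) ^ 4 <=
    C * #|` V| ^ 2 * (size Z * size W) ^ 3)%N.

(** Square [m^2 <= |V| E] and insert [E^2 <= C N^3] for the energy [E]; the successor makes the
    constant positive. *)
Theorem energy_constant_exists : exists2 C, (0 < C)%N & energy_constant C.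
Proof.
have [C HC] := point_plane_incidences; exists C.+1 => // F p Z W V k pF uZ uW Z0 sW sZ cZ leNk leNp.
have sT : size (triples Z W) = (size Z * size W)%N by rewrite size_allpairs.
have uT := triples_uniq uZ uW.
have T0 : {in triples Z W, forall x, x.1.2 != 0} by move=> x /triplesP[/Z0].
have colT S : uniq S -> {subset S <= triples Z W} -> {in S & &, forall x y z, collinear x y z} ->
    (size S <= k)%N.
  by move=> uS sS colS; apply: collinear_triples_size uS sS colS sW sZ cZ.
have := HC F p _ _ _ k pF uT uT T0 T0 (eq_leq sT) (eq_leq sT) colT leNk leNp.
rewrite -energy_swap; have := energy_lower_bound (triples Z W) V.
move: (count _ _) (\sum_(y <- _) _)%N (#|` V|) (_ ^ 3)%N => m E v N3 lem leE.
rewrite (_ : 4 = 2 * 2)%N // expnM; apply: (@leq_trans ((v * E) ^ 2)); first by rewrite leq_exp2r.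
rewrite expnMn (mulnC C.+1) -mulnA leq_mul2l (leq_trans leE) ?orbT //.
by rewrite leq_mul2r leqnSn orbT.
Qed.

(** * Expanders *)

Section Expanders.
Variables (C : nat) (F : fieldType) (p : nat).
Hypotheses (HC : energy_constant C) (pF : p \in [pchar F]).
Implicit Types (A X Y W V : {fset F}) (g : F -> F -> F).

(** The values become [g a b + b * c]: [g a b = a] gives [a + b c], and [g a b = b a] gives
    [b (a + c)]. *)
Definition pairs g X Y : seq (F * F) := [seq (g a b, b) | a <- enum_fset X, b <- enum_fset Y].

Lemma pairs_uniq g X Y : {in Y, forall b, injective (g^~ b)} -> uniq (pairs g X Y).
Proof.
move=> inj_g; apply: allpairs_uniq => //; try exact: fset_uniq.
move=> [a b] [a' b'] /allpairsP[[a1 b1] /= [_ bY [-> ->]]] _ /= [gE bE].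
by rewrite -bE in gE *; rewrite (inj_g _ bY _ _ gE).
Qed.

Lemma size_pairs g X Y : size (pairs g X Y) = (#|` X| * #|` Y|)%N.
Proof. by rewrite size_allpairs. Qed.

Lemma pairs_snd g X Y : (size (undup (map snd (pairs g X Y))) <= #|` Y|)%N.
Proof.
apply: uniq_leq_size; first exact: undup_uniq.
move=> b; rewrite mem_undup => /mapP[s /allpairsP[[a b'] /= [_ bY ->]] ->] //.
Qed.

Lemma pairs_fiber g X Y b : uniq (pairs g X Y) ->
  (count (fun s : F * F => s.2 == b) (pairs g X Y) <= #|` X|)%N.
Proof.
move=> u; rewrite -size_filter -(size_map (fun a => (g a b, b)) (enum_fset X)).
apply: uniq_leq_size; first exact: filter_uniq.
move=> s; rewrite mem_filter => /andP[/eqP <- /allpairsP[[a b'] /= [aX bY ->]]] /=.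
by apply/mapP; exists a.
Qed.

Lemma pairs_energy g X Y W V k :
  {in Y, forall b, injective (g^~ b)} -> 0 \notin Y ->
  (#|` X| <= k)%N -> (#|` Y| <= k)%N -> (#|` W| <= k)%N ->
  (k ^ 8 <= (#|` X| * #|` Y| * #|` W|) ^ 3)%N -> (#|` X| * #|` Y| * #|` W| <= p ^ 2)%N ->
  ((count (fun x => value x \in V) (triples (pairs g X Y) (enum_fset W))) ^ 4 <=
    C * #|` V| ^ 2 * (#|` X| * #|` Y| * #|` W|) ^ 3)%N.
Proof.
move=> inj_g Y0 sX sY sW lek lep; have u := pairs_uniq X inj_g.
rewrite -(size_pairs g) in lek lep *.
apply: (@HC F p _ (enum_fset W) V k pF u (fset_uniq W) _ sW _ _ lek lep).
- by move=> s /allpairsP[[a b] /= [_ bY ->]] /=; apply: contraNneq Y0 => <-.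
- exact: leq_trans (pairs_snd g X Y) sY.
- by move=> b; apply: leq_trans (pairs_fiber b u) sX.
Qed.

(** All [N] triples have value in [V], so [N^4 <= C |V|^2 N^3] and [N^3] cancels. *)
Lemma pairs_expand g X Y W V k :
  {in Y, forall b, injective (g^~ b)} -> 0 \notin Y ->
  (#|` X| <= k)%N -> (#|` Y| <= k)%N -> (#|` W| <= k)%N ->
  (k ^ 8 <= (#|` X| * #|` Y| * #|` W|) ^ 3)%N -> (#|` X| * #|` Y| * #|` W| <= p ^ 2)%N ->
  (forall a b c, a \in X -> b \in Y -> c \in W -> g a b + b * c \in V) ->
  (#|` X| * #|` Y| * #|` W| <= C * #|` V| ^ 2)%N.
Proof.
move=> inj_g Y0 sX sY sW lek lep inV.
have := pairs_energy V inj_g Y0 sX sY sW lek lep.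
have /eqP -> : count (fun x => value x \in V) (triples (pairs g X Y) (enum_fset W))
    == (#|` X| * #|` Y| * #|` W|)%N.
  have -> : (#|` X| * #|` Y| * #|` W|)%N = size (triples (pairs g X Y) (enum_fset W)).
    by rewrite size_allpairs size_pairs.
  rewrite -all_count; apply/allP => x /triplesP[/allpairsP[[a b] /= [aX bY xE]] cW].
  by rewrite /value xE /=; apply: inV.
have [->//|N0] := posnP (#|` X| * #|` Y| * #|` W|)%N.
by rewrite expnS leq_pmul2r // expn_gt0 N0.
Qed.

Lemma sumset_prodset_expand X Y W k : 0 \notin Y ->
  (#|` X| <= k)%N -> (#|` Y| <= k)%N -> (#|` W| <= k)%N ->
  (k ^ 8 <= (#|` X| * #|` Y| * #|` W|) ^ 3)%N -> (#|` X| * #|` Y| * #|` W| <= p ^ 2)%N ->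
  (#|` X| * #|` Y| * #|` W| <= C * #|` sumset X (prodset Y W)| ^ 2)%N.
Proof.
move=> Y0 sX sY sW lek lep; apply: (@pairs_expand (fun a _ => a)) lek lep _ => //.
  by move=> b _ a a'.
by move=> a b c aX bY cW; apply: in_imfset2 => //; apply: in_imfset2.
Qed.

Lemma prodset_sumset_expand X Y W k : 0 \notin Y ->
  (#|` X| <= k)%N -> (#|` Y| <= k)%N -> (#|` W| <= k)%N ->
  (k ^ 8 <= (#|` X| * #|` Y| * #|` W|) ^ 3)%N -> (#|` X| * #|` Y| * #|` W| <= p ^ 2)%N ->
  (#|` X| * #|` Y| * #|` W| <= C * #|` prodset Y (sumset X W)| ^ 2)%N.
Proof.
move=> Y0 sX sY sW lek lep; apply: (@pairs_expand (fun a b => b * a)) lek lep _ => //.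
  by move=> b bY; apply: mulfI; apply: contraNneq Y0 => <-.
move=> a b c aX bY cW; rewrite -mulrDr; apply: in_imfset2 => //; exact: in_imfset2.
Qed.

(** Only part of the triples is known to land in [A + A]: the [n ^ 3] triples [(c, 1/b, a b)], of
    value [c + a]. *)
Lemma sumset_prodset_energy A k (n := #|` A|) (m := #|` prodset A A|) : 0 \notin A ->
  (n <= k)%N -> (m <= k)%N -> (k ^ 8 <= (n * n * m) ^ 3)%N -> (n * n * m <= p ^ 2)%N ->
  ((n ^ 3) ^ 4 <= C * #|` sumset A A| ^ 2 * (n * n * m) ^ 3)%N.
Proof.
move=> A0 sn sm lek lep; pose B := [fset b^-1 | b in A]%fset.
have inv_inj : injective (@GRing.inv F) by exact: invr_inj.
have sB : #|` B| = n by rewrite card_imfset.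
have B0 : 0 \notin B.
  by apply/imfsetP => -[b /= bA /eqP]; rewrite eq_sym invr_eq0 => /eqP b0; rewrite -b0 bA in A0.
have := @pairs_energy (fun a _ => a) A B (prodset A A) (sumset A A) k.
rewrite sB -/n -/m => /(_ (fun _ _ _ _ => id) B0 sn sn sm lek lep); apply: leq_trans.
rewrite leq_exp2r //.
pose L := [seq ((s.1, s.2^-1), a * s.2) |
  s <- [seq (c, b) | c <- enum_fset A, b <- enum_fset A], a <- enum_fset A].
have sL : size L = (n ^ 3)%N by rewrite !size_allpairs -!/(n) !expnS expn0 muln1 mulnA.
rewrite -sL -size_filter; apply: uniq_leq_size.
  apply: allpairs_uniq; last first.
  - move=> [[c b] a] [[c' b'] a'] /allpairsP[[s0 a0] /= [/allpairsP[[c1 b1] /= [_ bA ->]] _ [-> -> _]]].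
    move=> _ /= [-> /inv_inj <- E].
    have b10 : b1 != 0 by apply: contraNneq A0 => <-.
    by rewrite (mulIf b10 E).
  - exact: fset_uniq.
  - apply: allpairs_uniq; [exact: fset_uniq | exact: fset_uniq|].
    by move=> [? ?] [? ?].
move=> x /allpairsP[[s a] /= [/allpairsP[[c b] /= [cA bA ->]] aA ->]]; rewrite mem_filter /=.
have b0 : b != 0 by apply: contraNneq A0 => <-.
apply/andP; split.
  rewrite /value /= mulrCA mulVf // mulr1; exact: in_imfset2.
apply/triplesP; split => /=; last exact: in_imfset2.
by apply/allpairsP; exists (c, b^-1); split=> //=; apply/imfsetP; exists b.
Qed.
End Expanders.

(** * Cardinality bounds for the expanders *)

Lemma subset_of_size (T : choiceType) (X : {fset T}) s : (s <= #|` X|)%N ->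
  exists2 Y : {fset T}, (Y `<=` X)%fset & #|` Y| = s.
Proof.
move=> leX; exists [fset x in take s (enum_fset X)]%fset.
  by apply/fsubsetP => x; rewrite inE /= => /mem_take.
by rewrite card_fseq undup_id ?take_uniq ?fset_uniq // size_takel.
Qed.

Lemma sumsetS (F : fieldType) (X X' Y Y' : {fset F}) :
  (X `<=` X')%fset -> (Y `<=` Y')%fset -> (sumset X Y `<=` sumset X' Y')%fset.
Proof.
move=> /fsubsetP sX /fsubsetP sY; apply/fsubsetP => z /imfset2P[x /= xX [y /= yY ->]].
by apply: in_imfset2; [apply: sX | apply: sY].
Qed.

Lemma prodsetS (F : fieldType) (X X' Y Y' : {fset F}) :
  (X `<=` X')%fset -> (Y `<=` Y')%fset -> (prodset X Y `<=` prodset X' Y')%fset.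
Proof.
move=> /fsubsetP sX /fsubsetP sY; apply/fsubsetP => z /imfset2P[x /= xX [y /= yY ->]].
by apply: in_imfset2; [apply: sX | apply: sY].
Qed.

Section CardinalityBounds.
Variables (C : nat) (F : fieldType) (p : nat) (A : {fset F}).
Hypotheses (C0 : (0 < C)%N) (HC : energy_constant C) (pF : p \in [pchar F]).
Hypotheses (A0 : 0 \notin A) (A1 : (0 < #|` A|)%N).
Local Notation n := #|` A|.

Lemma expand_A_AA : (n ^ 3 <= p ^ 2)%N ->
  (n ^ 3 <= C * #|` sumset A (prodset A A)| ^ 2)%N /\
  (n ^ 3 <= C * #|` prodset A (sumset A A)| ^ 2)%N.
Proof.
have nE : (n ^ 3 = n * n * n)%N by rewrite !expnS expn0 muln1 mulnA.
have n8 : (n ^ 8 <= (n ^ 3) ^ 3)%N by rewrite -expnM; apply: leq_pexp2l.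
rewrite nE in n8 *; move=> leNp; split.
  exact: (sumset_prodset_expand HC pF A0 (leqnn _) (leqnn _) (leqnn _)).
exact: (prodset_sumset_expand HC pF A0 (leqnn _) (leqnn _) (leqnn _)).
Qed.

(** One copy of [A] may be replaced by a set of size up to [n^(6/5)]: the first condition amounts to
    [s^5 <= n^6], and [s n^2 <= n^(16/5) <= p^2]. *)
Lemma size_conditions s : (n ^ 8 <= p ^ 5)%N -> (n <= s)%N -> (s ^ 5 <= n ^ 6)%N ->
  (s ^ 8 <= (s * n * n) ^ 3)%N /\ (s * n * n <= p ^ 2)%N.
Proof.
move=> leNp ns s5; split.
  have -> : (s ^ 8 = s ^ 3 * s ^ 5)%N by rewrite -expnD.
  have -> : ((s * n * n) ^ 3 = s ^ 3 * n ^ 6)%N by move: n => a; ring.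
  by rewrite leq_mul2l s5 orbT.
rewrite -(@leq_exp2r _ _ 5) //.
have -> : ((s * n * n) ^ 5 = s ^ 5 * n ^ 10)%N by move: n => a; ring.
apply: (@leq_trans (n ^ 6 * n ^ 10)%N); first by rewrite leq_mul2r s5 orbT.
have -> : (n ^ 6 * n ^ 10 = (n ^ 8) ^ 2)%N by rewrite -expnD -expnM.
have -> : ((p ^ 2) ^ 5 = (p ^ 5) ^ 2)%N by rewrite -!expnM.
by rewrite leq_exp2r.
Qed.

(** The integer part of [n^(6/5)]; the 32 comes from [s + 1 <= 2 s]. *)
Lemma fifth_root : exists s, [/\ (n <= s)%N, (s ^ 5 <= n ^ 6)%N & (n ^ 6 <= 32 * s ^ 5)%N].
Proof.
have exs : exists s, (s ^ 5 <= n ^ 6)%N by exists 0%N.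
have bound s : (s ^ 5 <= n ^ 6)%N -> (s <= n ^ 6)%N.
  by apply: leq_trans; case: s => // s; rewrite -{1}[s.+1]expn1; apply: leq_pexp2l.
have [s s5 maxs] := ex_maxnP exs bound.
have ns : (n <= s)%N by apply: maxs; apply: leq_pexp2l.
exists s; split=> //; apply: (@leq_trans (s.+1 ^ 5)).
  by rewrite leqNgt; apply/negP => /ltnW/maxs; rewrite ltnn.
have -> : (32 * s ^ 5 = (2 * s) ^ 5)%N by rewrite expnMn.
by rewrite leq_exp2r //; lia.
Qed.

Lemma prodset_ge : (n <= #|` prodset A A|)%N.
Proof.
have /fset0Pn[a aA] : A != fset0 by rewrite -cardfs_gt0.
have a0 : a != 0 by apply: contraNneq A0 => <-.
rewrite -(card_imfset imfset_key (mem A) (mulfI a0)) /=; apply: fsubset_leq_card.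
by apply/fsubsetP => _ /imfsetP[b /= bA ->]; apply: in_imfset2.
Qed.

(** The doubles of elements of [A] are distinct and nonzero in odd characteristic. *)
Lemma sumset_nonzero_ge : odd p -> (n <= #|` (sumset A A `\ (0 : F)%R)%fset|)%N.
Proof.
move=> oddp; have two0 : (2%:R : F) != 0.
  rewrite -(dvdn_pcharf pF); apply/negP => /(dvdn_leq (isT : 0 < 2)%N).
  have := prime_gt1 (pcharf_prime pF); move=> p1 p2.
  by have p2' : p = 2%N; [lia | move: oddp; rewrite p2'].
rewrite -(card_imfset imfset_key (mem A) (mulfI two0)) /=; apply: fsubset_leq_card.
apply/fsubsetP => _ /imfsetP[b /= bA ->]; rewrite !inE; apply/andP; split.
  by rewrite mulf_neq0 //; apply: contraNneq A0 => <-.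
by rewrite mulr2n mulrDl mul1r; apply: in_imfset2.
Qed.

(** Let [s] be about [n^(6/5)]. If [AA], or the nonzero part of [A + A], has at least [s] elements,
    a subset of size [s] replaces one copy of [A]. If both are small, the energy bound still makes
    [A + A] of order [n^(6/5)], and its whole nonzero part is used. *)
Lemma expand_AA_AA : odd p -> (n ^ 8 <= p ^ 5)%N ->
  (n ^ 16 <= 32 * C ^ 8 * (#|` sumset (prodset A A) (prodset A A)| +
     #|` prodset (sumset A A) (sumset A A)|) ^ 10)%N.
Proof.
move=> oddp leNp; set S1 := sumset _ (prodset A A); set S2 := prodset _ (sumset A A).
have [s [ns s5 s5']] := fifth_root.
have root_case t : (s * n * n <= C * t ^ 2)%N -> (t <= #|` S1| + #|` S2|)%N ->
    (n ^ 16 <= 32 * C ^ 8 * (#|` S1| + #|` S2|) ^ 10)%N.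
  move=> le1 let_; apply: (@leq_trans (32 * (s * n * n) ^ 5)%N).
    have -> : (32 * (s * n * n) ^ 5 = 32 * s ^ 5 * n ^ 10)%N by move: n => a; ring.
    by rewrite (_ : 16 = 6 + 10)%N // expnD leq_mul2r s5' orbT.
  rewrite -(mulnA 32); apply: leq_mul => //; apply: (@leq_trans ((C * t ^ 2) ^ 5)%N).
    by rewrite leq_exp2r.
  rewrite expnMn -(expnM t); apply: leq_mul; first by apply: leq_pexp2l.
  by rewrite leq_exp2r.
have [ltm|lem] := ltnP s #|` prodset A A|.
  have [X subX sX] := subset_of_size (ltnW ltm).
  have [c8 cp] := size_conditions leNp ns s5.
  have := @sumset_prodset_expand C F p HC pF X A A s A0; rewrite sX => /(_ (leqnn _) ns ns c8 cp).
  move/root_case; apply; apply: leq_trans (leq_addr _ _).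
  by apply/fsubset_leq_card/sumsetS.
have nm := prodset_ge.
set m := #|` prodset A A| in lem nm.
have m5 : (m ^ 5 <= n ^ 6)%N by apply: leq_trans s5; rewrite leq_exp2r.
have [d8 dp] := size_conditions leNp nm m5.
have mE : (m * n * n = n * n * m)%N by rewrite (mulnC (n * n)%N) mulnA.
rewrite mE in d8 dp; have := sumset_prodset_energy HC pF A0 nm (leqnn m) d8 dp.
rewrite -/m; set u := #|` sumset A A| => energy.
(* Small [AA] gives large [A + A]: the energy bound reduces to [n^6 <= C u^2 m^3], whose fifth power
   meets [m^5 <= n^6]. *)
have n12 : (n ^ 12 <= C ^ 5 * u ^ 10)%N.
  have n6 : (n ^ 6 <= C * u ^ 2 * m ^ 3)%N.
    have n60 : (0 < n ^ 6)%N by rewrite expn_gt0 A1.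
    rewrite -(leq_pmul2l n60); move: energy.
    have -> : ((n ^ 3) ^ 4 = n ^ 6 * n ^ 6)%N by rewrite -expnM -expnD.
    have -> : (C * u ^ 2 * (n * n * m) ^ 3 = n ^ 6 * (C * u ^ 2 * m ^ 3))%N.
      by clear; move: n m u => a b c; ring.
    by [].
  have n180 : (0 < n ^ 18)%N by rewrite expn_gt0 A1.
  rewrite -(leq_pmul2r n180) -expnD.
  have -> : (n ^ (12 + 18) = (n ^ 6) ^ 5)%N by rewrite -expnM.
  apply: (@leq_trans ((C * u ^ 2 * m ^ 3) ^ 5)%N); first by rewrite leq_exp2r.
  have -> : ((C * u ^ 2 * m ^ 3) ^ 5 = C ^ 5 * u ^ 10 * (m ^ 5) ^ 3)%N by ring.
  have -> : (n ^ 18 = (n ^ 6) ^ 3)%N by rewrite -expnM.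
  by rewrite leq_mul2l leq_exp2r // m5 orbT.
(* The left factors must be nonzero, so 0 is removed from [A + A]; this costs at most a factor 2. *)
have y0n := sumset_nonzero_ge oddp; set Y0 := (sumset A A `\ (0 : F)%R)%fset in y0n.
have uy : (u <= 2 * #|` Y0|)%N.
  have uE : u = (((0 : F)%R \in sumset A A) + #|` Y0|)%N := cardfsD1 0 _.
  rewrite uE mul2n -addnn leq_add2r; apply: leq_trans (leq_trans A1 y0n).
  by case: ((0 : F)%R \in sumset A A).
have Y0sub Y : (Y `<=` Y0)%fset -> 0 \notin Y /\ (Y `<=` sumset A A)%fset.
  move=> subY; split; last exact: fsubset_trans subY (fsubD1set _ _).
  by apply/negP => /(fsubsetP subY); rewrite !inE eqxx.
have [lts|les] := leqP s #|` Y0|.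
  have [Y subY sY] := subset_of_size lts.
  have [c8 cp] := size_conditions leNp ns s5; have [nY YS] := Y0sub Y subY.
  have sE : (n * s * n = s * n * n)%N by rewrite (mulnC n).
  have := @prodset_sumset_expand C F p HC pF A Y A s nY.
  rewrite sY sE => /(_ ns (leqnn _) ns c8 cp).
  move/root_case; apply; apply: leq_trans (leq_addl _ _).
  by apply/fsubset_leq_card/prodsetS.
set y := #|` Y0| in y0n uy les.
have y5 : (y ^ 5 <= n ^ 6)%N by apply: leq_trans s5; rewrite leq_exp2r // ltnW.
have [c8 cp] := size_conditions leNp y0n y5; have [nY YS] := Y0sub Y0 (fsubset_refl _).
have yE : (n * y * n = y * n * n)%N by rewrite (mulnC n).
have := @prodset_sumset_expand C F p HC pF A Y0 A y nY.
rewrite -/y yE => /(_ y0n (leqnn _) y0n c8 cp).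
set t := #|` prodset Y0 (sumset A A)| => let_.
have tS : (t <= #|` S1| + #|` S2|)%N.
  by apply: leq_trans (leq_addl _ _); apply/fsubset_leq_card/prodsetS.
(* Squaring makes [n^32 = n^12 * n^20], where the first factor is bounded through [u <= 2 y] and the
   second completes [(y n n)^10]. *)
rewrite -(@leq_exp2r _ _ 2) //.
apply: (@leq_trans (C ^ 5 * (2 * y) ^ 10 * n ^ 20)%N).
  rewrite -expnM (_ : 16 * 2 = 12 + 20)%N // expnD leq_mul2r; apply/orP; right.
  by apply: leq_trans n12 _; rewrite leq_mul2l leq_exp2r // uy orbT.
have -> : (C ^ 5 * (2 * y) ^ 10 * n ^ 20 = C ^ 5 * 2 ^ 10 * (y * n * n) ^ 10)%N.
  by rewrite !expnMn; move: (y ^ 10)%N n (2 ^ 10)%N => a b c; ring.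
apply: (@leq_trans (C ^ 5 * 2 ^ 10 * (C * t ^ 2) ^ 10)%N).
  by rewrite leq_mul2l leq_exp2r // let_ orbT.
have -> : (C ^ 5 * 2 ^ 10 * (C * t ^ 2) ^ 10 = 2 ^ 10 * (C ^ 15 * t ^ 20))%N.
  by rewrite expnMn -expnM (_ : 15 = 5 + 10)%N // expnD; ring.
move: (#|` S1| + #|` S2|)%N tS => v tv.
have -> : ((32 * C ^ 8 * v ^ 10) ^ 2 = 32 ^ 2 * (C ^ 16 * v ^ 20))%N.
  by clear; ring.
apply: leq_mul => //; apply: leq_mul; first by apply: leq_pexp2l.
by rewrite leq_exp2r.
Qed.
End CardinalityBounds.

(** * Passage to real exponents *)

Lemma powR_ratio (R : realType) (x : R) (a b : nat) : 0 <= x -> (0 < b)%N ->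
  (x `^ (a%:R / b%:R)) ^+ b = x ^+ a.
Proof.
move=> x0 b0; rewrite -powR_mulrn ?powR_ge0 // -powRrM mulfVK ?powR_mulrn //.
by rewrite pnatr_eq0 -lt0n.
Qed.

Lemma lt_powR_ratio (R : realType) (m q a b : nat) : (0 < b)%N ->
  m%:R < (q%:R : R) `^ (a%:R / b%:R) -> (m ^ b <= q ^ a)%N.
Proof.
move=> b0 ltm; rewrite -(ler_nat R) !natrX -(powR_ratio a (ler0n R q) b0).
by rewrite ler_pXn2r ?nnegrE ?powR_ge0 // ltW.
Qed.

(** As [M <= M ^ b], the constant [1 / M] can stand in for the [b]-th root of [1 / M]. *)
Lemma powR_ratio_le (R : realType) (M m v a b : nat) : (0 < b)%N -> (0 < M)%N ->
  (m ^ a <= M * v ^ b)%N -> (M%:R)^-1 * (m%:R : R) `^ (a%:R / b%:R) <= v%:R.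
Proof.
move=> b0 M0 le_v; have M0' : 0 < M%:R :> R by rewrite ltr0n.
rewrite ler_pdivrMl // -(@ler_pXn2r _ b) ?nnegrE ?powR_ge0 ?mulr_ge0 ?ler0n //.
rewrite powR_ratio // exprMn -!natrX -natrM ler_nat (leq_trans le_v) // leq_mul2r.
by rewrite -{1}[M]expn1 leq_pexp2l ?orbT.
Qed.

Theorem corollary3 (R : realType) :
  exists c : R, 0 < c /\
    forall (F : fieldType) (p : nat) (A : {fset F}),
      p \in [pchar F] -> odd p ->
      0 \notin A -> (1 < #|` A|)%N ->
      ((#|` A|)%:R < (p%:R : R) `^ (2 / 3) ->
         c * (#|` A|)%:R `^ (3 / 2) <= (#|` sumset A (prodset A A)|)%:R /\
         c * (#|` A|)%:R `^ (3 / 2) <= (#|` prodset A (sumset A A)|)%:R) /\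
      ((#|` A|)%:R < (p%:R : R) `^ (5 / 8) ->
         c * (#|` A|)%:R `^ (8 / 5) <=
           (#|` sumset (prodset A A) (prodset A A)|)%:R +
           (#|` prodset (sumset A A) (sumset A A)|)%:R).
Proof.
(* The constant of [expand_AA_AA], which also dominates the constant [C] of part (a). *)
have [C C0 HC] := energy_constant_exists; pose M := (32 * C ^ 8)%N.
have M0 : (0 < M)%N by rewrite muln_gt0 expn_gt0 C0.
have CM : (C <= M)%N.
  by apply: leq_trans (leq_pmull _ _) => //; rewrite -{1}[C]expn1 leq_pexp2l.
exists M%:R^-1; split=> [|F p A pF oddp A0 A1]; first by rewrite invr_gt0 ltr0n.
split=> [lt_p|lt_p].
  have [le1 le2] := expand_A_AA HC pF A0 (ltnW A1) (lt_powR_ratio (isT : 0 < 3)%N lt_p).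
  have weaken v : (#|` A| ^ 3 <= C * v ^ 2 -> #|` A| ^ 3 <= M * v ^ 2)%N.
    by move=> /leq_trans; apply; rewrite leq_mul2r CM orbT.
  by split; apply: powR_ratio_le => //; apply: weaken.
(* The exponent is written as 16/10 to match the integer bound between a 16th and a 10th power. *)
rewrite -natrD (_ : 8 / 5 = 16%:R / 10%:R :> R); last by field.
apply: powR_ratio_le => //.
exact: expand_AA_AA C0 HC pF A0 (ltnW A1) oddp (lt_powR_ratio (isT : 0 < 8)%N lt_p).
Qed.
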